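(* Let $d=1$ and suppose the weight vector $w$ and the noise $\xi$ satisfy assumptions (W1), (X) and (W2) of the context. 1. For each fixed $i\in\mathbb Z$ and $t\in\mathbb Z^+$, the process $\{h_{[t-s,t]}(i)-h_{[t-s,t]}(i-1): s\in\mathbb Z^+\}$ is an $L^2$-martingale with respect to the filtration $(\mathcal F_s)_{s\ge 0}$, where $\mathcal F_s=\sigma(\xi_{t-s+1}(\cdot),\ldots,\xi_t(\cdot))$. Furthermore, $h_{[t-s,t]}(i)-h_{[t-s,t]}(i-1)$ converges both almost surely and in $L^2$-norm as $s\to\infty$. Denote the limit by $\Delta_t(i)$, $i\in\mathbb Z$. 2. $\{\Delta_t\}_{t\in\mathbb Z^+}$ (with $\Delta_t=\{\Delta_t(i)\}_{i\in\mathbb Z}$) is a stationary Markov process. The distribution of $\Delta_0$ is an invariant measure for the increment process $\eta_t(\cdot)$, and it is ergodic under spatial shifts.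
   Context: $\mathbb Z^+$ is the set of nonnegative integers. (W1): $w=\{w(k)\}_{k\in\mathbb Z}$ satisfies $0\le w(k)<1$ for all $k$, $\sum_k w(k)=1$, and $\mathrm{supp}(w)=\{k: w(k)>0\}$ is finite. (W2) (span 1): $\max\{k\in\mathbb Z^+ : \exists \ell\in\mathbb Z \text{ with } \mathrm{supp}(w)\subset \ell+k\mathbb Z\}=1$. (X): $\{\xi_t(k)\}_{k\in\mathbb Z,t\in\mathbb Z}$ are i.i.d. real random variables with mean zero and variance $\sigma_\xi^2<\infty$. Transition kernel: $p(i,j)=w(j-i)$, with multistep transition probabilities $p^k(i,j)$, $p^0(i,j)=\mathbf 1\{i=j\}$. For $s<t$ in $\mathbb Z$, $h_{[s,t]}(i)=\sum_{j\in\mathbb Z}\sum_{k=s+1}^{t}\xi_k(j)p^{t-k}(i,j)$, and $h_{[s,s]}(i)=0$; this is the height at time $t$ of the harness process $h_{t+1}(i)=\sum_k w(k)h_t(i+k)+\xi_{t+1}(i)$ started at time $s$ from the flat configuration $0$. The increment process $\eta_t(i)=h_t(i)-h_t(i-1)$ of a harness process evolves by $$\eta_{t+1}(i)=\sum_{k\in\mathbb Z}w(k)\eta_t(i+k)+\xi_{t+1}(i)-\xi_{t+1}(i-1),\quad i\in\mathbb Z,\ t\in\mathbb Z^+,$$ with $\eta_0$ independent of $\{\xi_k(i)\}_{k\ge 1,i\in\mathbb Z}$. A probability measure $\nu$ on $\mathbb R^{\mathbb Z}$ is invariant for $\eta_t$ if $\eta_0\sim\nu$ implies $\eta_1\sim\nu$.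 The shifts are $(\theta_x\eta)(i)=\eta(i+x)$. $\nu$ is shift invariant if $\nu(\theta_xA)=\nu(A)$ for all Borel $A\subseteq\mathbb R^{\mathbb Z}$ and $x\in\mathbb Z$. A shift-invariant $\nu$ is ergodic if $\nu(B)\in\{0,1\}$ for every Borel $B$ with $\theta_xB=B$ for all $x\in\mathbb Z$. *)

(* Defs.v *)
From HB Require Import structures.
From mathcomp Require Export all_boot all_order all_algebra.
From mathcomp Require Export all_classical all_reals all_analysis.

Set Implicit Arguments.
Unset Strict Implicit.
Unset Printing Implicit Defensive.

Export Order.TTheory GRing.Theory Num.Theory.
Export numFieldNormedType.Exports.

Local Open Scope classical_set_scope.
Local Open Scope ring_scope.

(* R^Z with the Borel sigma-algebra of the product topology. *)
Notation RZ R := (g_sigma_algebraType (@open {ptws int -> R})).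

(* sigma(X_i : i in K) *)
Definition sigma_of (T I : Type) d (S : measurableType d) (K : set I)
    (X : I -> T -> S) : set (set T) :=
  <<s \bigcup_(i in K) preimage_set_system setT (X i) measurable >>.

Definition mutually_independent d (T : measurableType d) (R : realType)
    (P : probability T R) (I : eqType) d' (S : measurableType d')
    (X : I -> T -> S) : Prop :=
  forall (J : seq I) (A : I -> set S), uniq J -> (forall a, measurable (A a)) ->
    P (\bigcap_(a in [set` J]) X a @^-1` A a) =
    (\prod_(a <- J) P (X a @^-1` A a))%E.

(* Y is a version of E[X | G], for G a sub-sigma-algebra and X integrable. *)
Definition is_cond_exp d (T : measurableType d) (R : realType)
    (P : probability T R) (G : set (set T)) (X Y : T -> R) : Prop :=
  [/\ forall B : set R, measurable B -> G (Y @^-1` B),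
      Y \in Lfun P 1
    & forall A, G A ->
        (\int[P]_(x in A) (Y x)%:E = \int[P]_(x in A) (X x)%:E)%E ].

Definition is_filtration d (T : measurableType d) (F : nat -> set (set T)) : Prop :=
  [/\ forall n, sigma_algebra setT (F n),
      forall n, F n `<=` measurable
    & forall m n, (m <= n)%N -> F m `<=` F n ].

(* Adaptedness is the first clause of [is_cond_exp], at m = n. *)
Definition L2_martingale d (T : measurableType d) (R : realType)
    (P : probability T R) (F : nat -> set (set T)) (M : nat -> T -> R) : Prop :=
  [/\ is_filtration F,
      forall n, M n \in Lfun P 2%:E
    & forall m n, (m <= n)%N -> is_cond_exp P (F m) (M n) (M m) ].

Definition cvg_as_L2 d (T : measurableType d) (R : realType)
    (P : probability T R) (M : nat -> T -> R) (D : T -> R) : Prop :=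
  [/\ {ae P, forall x, M n x @[n --> \oo] --> D x},
      D \in Lfun P 2%:E
    & ('N[P]_2%:E[EFin \o (M n \- D)%R] @[n --> \oo] --> 0)%E ].

Definition stationary_process d (T : measurableType d) (R : realType)
    (P : probability T R) d' (S : measurableType d') (X : nat -> T -> S) : Prop :=
  forall (n m : nat) (u : 'I_n -> nat) (A : set (n.-tuple S)), measurable A ->
    P [set x | A [tuple X (u i + m)%N x | i < n]] =
    P [set x | A [tuple X (u i) x | i < n]].

(* P(X_{t+1} \in A | X_0, ..., X_t) = P(X_{t+1} \in A | X_t) almost surely:
   the two conditional probabilities have a common version. *)
Definition markov_process d (T : measurableType d) (R : realType)
    (P : probability T R) d' (S : measurableType d') (X : nat -> T -> S) : Prop :=
  forall (t : nat) (A : set S), measurable A ->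
    exists Y : T -> R,
      is_cond_exp P (sigma_of [set t] X) (\1_(X t.+1 @^-1` A)) Y /\
      is_cond_exp P (sigma_of [set u | (u <= t)%N] X) (\1_(X t.+1 @^-1` A)) Y.

Definition weight (R : realType) (w : int -> R) : Prop :=
  [/\ forall k, 0 <= w k < 1,
      finite_set [set k | 0 < w k]
    & \sum_(k \in [set: int]) w k = 1 ].

(* 1 is the maximum of the k >= 0 such that supp w is contained in some
   coset l + kZ. *)
Definition span1 (R : realType) (w : int -> R) : Prop :=
  let S := [set k : nat | exists l : int,
              [set j | 0 < w j] `<=` [set l + k%:Z * m | m in [set: int]]] in
  S 1%N /\ forall k, S k -> (k <= 1)%N.

Definition iid_law d (T : measurableType d) (R : realType)
    (P : probability T R) (xi : int -> int -> {RV P >-> R})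
    (mu : probability R R) : Prop :=
  mutually_independent P (fun (a : int * int) (x : T) => xi a.1 a.2 x) /\
  forall (k j : int) (A : set R), measurable A ->
    distribution P (xi k j) A = mu A.

Definition noise d (T : measurableType d) (R : realType)
    (P : probability T R) (xi : int -> int -> {RV P >-> R})
    (mu : probability R R) : Prop :=
  [/\ iid_law xi mu,
      forall k j, (xi k j : T -> R) \in Lfun P 1,
      forall k j, ('E_P[xi k j] = 0)%E
    & forall k j, ('V_P[xi k j] < +oo)%E ].

(* p^n(i, j) for the kernel p(i, j) = w (j - i) *)
Fixpoint pstep (R : realType) (w : int -> R) (n : nat) (i j : int) : R :=
  match n with
  | 0 => (i == j)%:R
  | n'.+1 => \sum_(l \in [set: int]) w (l - i) * pstep w n' l j
  end.

(* h_{[s,t]}(i); the first argument of xi is time. Both sums have finitely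
   many nonzero terms when w has finite support. *)
Definition height (R : realType) (w : int -> R) (xi : int -> int -> R)
    (s t i : int) : R :=
  \sum_(j \in [set: int]) \sum_(k \in [set k : int | s < k <= t])
    xi k j * pstep w `|t - k|%N i j.

Definition height_incr (R : realType) (w : int -> R) (xi : int -> int -> R)
    (s t i : int) : R :=
  height w xi s t i - height w xi s t (i - 1).

Definition past_noise d (T : measurableType d) (R : realType)
    (P : probability T R) (xi : int -> int -> {RV P >-> R})
    (t : int) (s : nat) : set (set T) :=
  sigma_of [set a : int * int | t - s%:Z < a.1 <= t]
           (fun (a : int * int) (x : T) => xi a.1 a.2 x).

Fixpoint increments (R : realType) (w : int -> R) (xi : int -> int -> R)
    (eta0 : RZ R) (t : nat) : RZ R :=
  match t with
  | 0 => eta0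
  | t'.+1 => fun i : int =>
      \sum_(k \in [set: int]) w k * increments w xi eta0 t' (i + k)
      + xi t'.+1%:Z i - xi t'.+1%:Z (i - 1)
  end.

(* The invariance is required for every realization, on any probability space,
   of an initial state with law nu and of an i.i.d. noise with law mu
   (independent of the initial state at times k >= 1). *)
Definition invariant_law (R : realType) (w : int -> R) (mu : probability R R)
    (nu : set (RZ R) -> \bar R) : Prop :=
  forall d (T : measurableType d) (P : probability T R)
      (xi : int -> int -> {RV P >-> R}) (eta0 : {RV P >-> RZ R}),
    iid_law xi mu ->
    (forall (A : set (RZ R)) (B : set T), measurable A ->
       sigma_of [set a : int * int | 1 <= a.1]
                (fun (a : int * int) (x : T) => xi a.1 a.2 x) B ->
       (P (eta0 @^-1` A `&` B) = P (eta0 @^-1` A) * P B)%E) ->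
    (forall A : set (RZ R), measurable A -> distribution P eta0 A = nu A) ->
    forall A : set (RZ R), measurable A ->
      P [set x | A (increments w (fun k j => xi k j x) (eta0 x) 1%N)] = nu A.

Definition shiftZ (R : realType) (x : int) (e : RZ R) : RZ R :=
  fun i : int => e (i + x).

Definition shift_invariant (R : realType) (nu : set (RZ R) -> \bar R) : Prop :=
  forall (A : set (RZ R)) (x : int), measurable A -> nu (shiftZ x @` A) = nu A.

Definition ergodic (R : realType) (nu : set (RZ R) -> \bar R) : Prop :=
  shift_invariant nu /\
  forall B : set (RZ R), measurable B -> (forall x, shiftZ x @` B = B) ->
    (nu B = 0 \/ nu B = 1)%E.

(* Main.v *)
From mathcomp Require Import finmap.
Require Import Defs.
From mathcomp Require Import ring lra zify measurable_realfun.

(* An increment of the height started s steps in the past is a sum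
   of s independent centered layers, the layer at lag n being the noise tested
   against the increment of p^n.  The martingale is bounded in L^2 once
   sum_n |p^n - tau_1 p^n|_2^2 is finite.  Since |p^n|_2^2 - |p^(n+1)|_2^2
   is half the w x w average of |tau_k p^n - tau_l p^n|_2^2, that sum converges
   when the shift 1 is replaced by a difference of two points of the support of
   w; the shifts for which it converges form a subgroup of Z, which is Z by the
   span hypothesis.  Kolmogorov's maximal inequality then gives almost sure
   convergence.  The limit at time t is a fixed measurable functional of the
   noise translated by t, whence stationarity in time and space; one step of the
   harness dynamics is driven by a noise row independent of the past, whence the
   Markov property and invariance; and translates of events depending on a strip
   of the noise are eventually independent, whence ergodicity. *)

(** The sigma-algebras are not completed, and [Delta] is an arbitrary family of random fields to
    which the height increments converge. So [Delta t] is determined only up to a null set, and its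
    past need not lie in the sigma-algebra of the past noise. The work is therefore done on one
    everywhere defined measurable functional of a noise configuration, [incr_limit], and each
    conclusion passes to [Delta] through almost sure equality of events. The energy bound comes from
    a telescoping sum: |p^n|_2^2 starts at 1, decreases and stays nonnegative, so its total drop is
    at most 1. The span hypothesis is what brings the shift 1 within reach. If the support of w lay
    in a coset of gZ with g > 1, then p^n and its translate by 1 would have disjoint supports, and
    the n-th energy would be 2 |p^n|_2^2, whose sum diverges in dimension one. A single
    orthogonality relation, of later increments against every square integrable variable of the
    past, yields both the martingale property and the maximal inequality. *)

Set Implicit Arguments.
Unset Strict Implicit.
Unset Printing Implicit Defensive.

Local Open Scope classical_set_scope.
Local Open Scope ring_scope.

(** * Borel sets of product spaces *)

Notation field I R := (g_sigma_algebraType (@open {ptws I -> R})).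

Section product_borel.
Context (I : countType) (R : realType).
Implicit Types (f : field I R) (s : seq (I * rat * rat)).

(** Rational endpoints make the boxes countable in number, which turns an arbitrary open set into a
    countable union of boxes in [field_measurableP]. *)
Definition box s : set (I -> R) :=
  [set f | all (fun c => ratr c.1.2 < f c.1.1 < ratr c.2) s].

(** The product topology is a supremum of initial topologies, so it is enough that the filter of
    sets containing a box around [f] refines the neighbourhoods of each coordinate; there a single
    rational interval does. *)
Lemma ptws_nbhs_box (f : {ptws I -> R}) (U : set {ptws I -> R}) :
  nbhs f U -> exists2 s, box s f & box s `<=` U.
Proof.
pose F : set_system {ptws I -> R} :=
  [set V | exists2 s, box s f & box s `<=` V].
have FF : Filter F.
  split; first by exists [::].
    move=> V W [s sf sV] [t tf tW]; exists (s ++ t).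
      by rewrite /box /= all_cat (sf : all _ _) (tf : all _ _).
    move=> g; rewrite /box /= all_cat => /andP[gs gt].
    by split; [exact: sV|exact: tW].
  by move=> V W VW [s sf sV]; exists s => //; apply: subset_trans VW.
suff : F --> f by apply.
apply/cvg_sup => i V.
have -> := @nbhsE (initial_topology (fun g : {ptws I -> R} => g i)) f.
move=> [_ [[C oC <-] Cf] CV]; rewrite /= in Cf.
have [e /= e0 eC] := open_nbhs_nbhs (conj oC Cf : open_nbhs (f i) C).
have [p] : exists p, ratr p \in `](f i - e), (f i)[.
  by apply: rat_in_itvoo; rewrite ltrBlDr ltrDl.
have [q] : exists q, ratr q \in `](f i), (f i + e)[.
  by apply: rat_in_itvoo; rewrite ltrDl.
rewrite !in_itv /= => /andP[q1 q2] /andP[p1 p2].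
exists [:: (i, p, q)]; first by rewrite /box /= p2 q1.
move=> g; rewrite /box /= andbT => /andP[pg gq]; apply: CV; apply: eC => /=.
by rewrite /ball_ /= ltr_norml; lra.
Qed.

Lemma field_coord_measurable (i : I) :
  measurable_fun setT (fun f : field I R => f i).
Proof.
apply: (measurability _ (RGenOpens.measurableE R)) => _ [_ [a [b ->]] <-].
apply: sub_sigma_algebra; rewrite setTI.
apply: (@open_comp _ _ (fun f : {ptws I -> R} => f i));
  last exact: interval_open.
by move=> f _; apply: (@proj_continuous I (fun=> R) i).
Qed.

Lemma box_sigma d (T : measurableType d) (g : T -> I -> R) :
  (forall i, measurable_fun setT (fun x => g x i)) ->
  forall s, measurable (g @^-1` box s).
Proof.
move=> mg; elim=> [|[[i p] q] s IH].
  by rewrite (_ : _ @^-1` _ = setT) //; apply/seteqP.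
rewrite (_ : _ @^-1` _ =
  ((fun x => g x i) @^-1` `](ratr p), (ratr q)[) `&` (g @^-1` box s)).
  by apply: measurableI => //; rewrite -[X in measurable X]setTI; exact: mg.
apply/seteqP; split => x; rewrite /box /= in_itv /=; first by case/andP.
by case=> -> ->.
Qed.

Lemma field_measurableP d (T : measurableType d) (g : T -> field I R) :
  (forall i, measurable_fun setT (fun x => g x i)) -> measurable_fun setT g.
Proof.
move=> mg; refine (@measurability _ _ T (field I R) setT g (@open {ptws I ->
  R}) erefl _).
move=> _ [U oU <-]; rewrite setTI.
have -> : g @^-1` U = \bigcup_(s in [set s | box s `<=` U]) (g @^-1` box s).
  apply/seteqP; split => x /=.
    move=> Ux; have [s sx sU] := ptws_nbhs_box (open_nbhs_nbhs (conj oU Ux)).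
    by exists s.
  by move=> [s sU sx]; exact: sU.
rewrite bigcup_mkcond; apply: countable_bigcupT_measurable => // s.
by case: ifPn => // _; exact: box_sigma.
Qed.

End product_borel.

(** * Independent fields *)

Section fields.
Context (I : countType) (R : realType) d (T : measurableType d)
  (P : probability T R).
Implicit Types (K L : set I) (J : seq I).

(** Taking [A] total, with value [setT] off the finite list [J], makes the intersection of two
    cylinders a coordinatewise intersection. *)
Definition cylinder K (X : I -> T -> R) : set (set T) :=
  [set C | exists J (A : I -> set R),
     [/\ uniq J, forall a, measurable (A a), forall a, a \in J -> K a,
         forall a, a \notin J -> A a = setT
       & C = [set x | forall a, A a (X a x)] ] ].

Lemma cylinder_setI_closed K X : setI_closed (cylinder K X).
Proof.
move=> _ _ [J [A [uJ mA JK AJ ->]]] [J' [A' [uJ' mA' JK' AJ' ->]]].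
exists (undup (J ++ J')), (fun a => A a `&` A' a); split.
- exact: undup_uniq.
- by move=> a; exact: measurableI.
- by move=> a; rewrite mem_undup mem_cat => /orP[/JK|/JK'].
- by move=> a; rewrite mem_undup mem_cat negb_or => /andP[/AJ -> /AJ' ->];
  rewrite setIT.
- apply/seteqP; split => [x [Ax A'x] a|x AA'x]; first by split.
  by split => a; have [] := AA'x a.
Qed.

Lemma cylinderT K X : cylinder K X setT.
Proof. by exists [::], (fun=> setT); split => //; apply/seteqP. Qed.

(** The generators of [sigma_of] are not stable under intersection; cylinders are, as the uniqueness
    of measures on a generated sigma-algebra requires. *)
Lemma sigma_of_cylinder K X : sigma_of K X `<=` <<s cylinder K X >>.
Proof.
apply: sub_smallest2r; first exact: smallest_sigma_algebra.
move=> _ [a Ka [B mB <-]].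
exists [:: a], (fun b => if b == a then B else setT); split => //.
- by move=> b; case: ifP.
- by move=> b; rewrite inE => /eqP ->.
- by move=> b; rewrite inE => /negbTE ->.
- apply/seteqP; split => [x [_ /= Bx] b|x /(_ a)/=]; last by rewrite eqxx.
  by case: eqP => // ->.
Qed.

Lemma sigma_of_measurable d' (S : measurableType d') (I' : Type) (K : set I')
    (X : I' -> T -> S) :
  (forall a, measurable_fun setT (X a)) -> sigma_of K X `<=` measurable.
Proof.
move=> mX; apply: smallest_sub; first exact: sigma_algebra_measurable.
by move=> _ [a _ [B mB <-]]; exact: mX.
Qed.

Lemma sigma_of_sub (I' : Type) d' (S : measurableType d') (K K' : set I')
    (X : I' -> T -> S) : K `<=` K' -> sigma_of K X `<=` sigma_of K' X.
Proof.
move=> KK'; apply: sub_smallest2r; first exact: smallest_sigma_algebra.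
exact: bigcup_subset.
Qed.

Section independence.
Variable X : I -> T -> R.
Hypotheses (mX : forall a, measurable_fun setT (X a))
  (iX : mutually_independent P X).

Lemma cylinder_prob J (A : I -> set R) : uniq J ->
  (forall a, measurable (A a)) -> (forall a, a \notin J -> A a = setT) ->
  P [set x | forall a, A a (X a x)] = (\prod_(a <- J) P (X a @^-1` A a))%E.
Proof.
move=> uJ mA AJ; rewrite -iX //; congr (P _).
apply/seteqP; split => x /= H a; first by move=> _; exact: H.
by have [/H//|/AJ ->] := boolP (a \in J).
Qed.

Lemma cylinder_sub_measurable K : cylinder K X `<=` measurable.
Proof.
move=> _ [J [A [uJ mA _ AJ ->]]].
rewrite (_ : [set _ | _] = \bigcap_(a in [set` J]) (X a @^-1` A a)).
  apply: fin_bigcap_measurable => // a _.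
  by rewrite -[_ @^-1` _]setTI; exact: mX.
apply/seteqP; split => x /= H a; first by move=> _; exact: H.
by have [/H//|/AJ ->] := boolP (a \in J).
Qed.

Lemma cylinder_indep K L B C : K `&` L = set0 ->
  cylinder K X B -> cylinder L X C -> (P (B `&` C) = P B * P C)%E.
Proof.
move=> KL [J [A [uJ mA JK AJ ->]]] [J' [A' [uJ' mA' JL AJ' ->]]].
have JJ' a : a \in J -> a \notin J'.
  by move=> /JK Ka; apply/negP => /JL La; have : (K `&` L) a by []; rewrite KL.
have J'J a : a \in J' -> a \notin J by move=> aJ'; apply: contraL aJ' => /JJ'.
rewrite (cylinder_prob uJ) // (cylinder_prob uJ') //.
rewrite (_ : _ `&` _ = [set x | forall a, (A a `&` A' a) (X a x)]); last first.
  apply/seteqP; split => [x [Ax A'x] a|x AA'x]; first by split.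
  by split => a; have [] := AA'x a.
rewrite (@cylinder_prob (J ++ J') (fun a => A a `&` A' a)); first last.
- by move=> a; rewrite mem_cat negb_or => /andP[/AJ -> /AJ' ->]; rewrite setIT.
- by move=> a; exact: measurableI.
- rewrite cat_uniq uJ uJ' andbT /=; apply/hasPn => a; exact: J'J.
rewrite big_cat /=; congr (_ * _)%E; rewrite big_seq [RHS]big_seq;
  apply: eq_bigr => a aJ.
- by rewrite AJ' ?setIT // JJ'.
- by rewrite AJ ?setTI // J'J.
Qed.

(** As functions of [B] both sides are finite measures, [P] restricted to [C] and [P] scaled by
    [P C]; they agree on a generating pi-system that contains the whole space. *)
Lemma indep_generated (G : set (set T)) C : G `<=` measurable ->
  setI_closed G -> G setT -> measurable C ->
  (forall B, G B -> (P (B `&` C) = P B * P C)%E) ->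
  forall B, <<s G >> B -> (P (B `&` C) = P B * P C)%E.
Proof.
move=> mG GI GT mC GC B sB.
have r0 : 0 <= fine (P C) by exact: fine_ge0.
have PCE : P C = (NngNum r0)%:num%:E by rewrite /= fineK // fin_num_measure.
rewrite PCE muleC.
apply: (g_sigma_algebra_measure_unique G mG (fun=> setT) _ _
  (mrestr P mC) (mscale (NngNum r0) P)) => //.
- by rewrite bigcup_const.
- by move=> A GA; rewrite /= /mrestr /mscale GC // -PCE muleC.
- by move=> _; rewrite /= /mrestr setTI ltey_eq fin_num_measure.
Qed.

(** The passage from cylinders to the generated sigma-algebra is made twice, one argument at a
    time. *)
Lemma sigma_of_indep K L B C : K `&` L = set0 ->
  sigma_of K X B -> sigma_of L X C -> (P (B `&` C) = P B * P C)%E.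
Proof.
move=> KL KB /sigma_of_cylinder LC.
have mKB := sigma_of_measurable mX KB.
rewrite setIC muleC.
apply: indep_generated LC => //; [exact: cylinder_sub_measurable|
  exact: cylinder_setI_closed|exact: cylinderT|move=> {}C LC].
rewrite setIC muleC.
move: KB => /sigma_of_cylinder; apply: indep_generated => //.
- exact: cylinder_sub_measurable.
- exact: cylinder_setI_closed.
- exact: cylinderT.
- exact: cylinder_sub_measurable LC.
- by move=> B' KB'; exact: cylinder_indep KB' LC.
Qed.

End independence.
End fields.

(** The identity map, from the coordinate sigma-algebra to the Borel one, is measurable because each
    of its coordinates is. *)
Lemma field_sigma_of (I : countType) (R : realType) (B : set (field I R)) :
  measurable B -> sigma_of setT (fun (a : I) (f : field I R) => f a) B.
Proof.
move=> mB; pose G := \bigcup_(a in [set: I])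
  preimage_set_system setT (fun f : field I R => f a) measurable.
have : measurable_fun setT (fun f : g_sigma_algebraType G => f : field I R).
  apply: field_measurableP => a _ C mC; apply: sub_gen_smallest.
  by exists a => //; exists C.
by move=> /(_ measurableT _ mB); rewrite setTI.
Qed.

(** On cylinders independence reduces everything to one-point marginals. Two probability spaces are
    allowed because invariance is tested against a noise living elsewhere. *)
Lemma field_law_unique (I : countType) (R : realType)
    d (T : measurableType d) (P : probability T R) (X : I -> T -> R)
    d' (T' : measurableType d') (P' : probability T' R) (X' : I -> T' -> R) :
  (forall a, measurable_fun setT (X a)) -> mutually_independent P X ->
  (forall a, measurable_fun setT (X' a)) -> mutually_independent P' X' ->
  (forall a A, measurable A -> P (X a @^-1` A) = P' (X' a @^-1` A)) ->
  forall B : set (field I R), measurable B ->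
    P ((fun x => X^~ x) @^-1` B) = P' ((fun x => X'^~ x) @^-1` B).
Proof.
move=> mX iX mX' iX' XX' B mB.
have mfX : measurable_fun setT (fun x => X^~ x : field I R).
  exact: field_measurableP.
have mfX' : measurable_fun setT (fun x => X'^~ x : field I R).
  exact: field_measurableP.
pose G := cylinder setT (fun a (f : field I R) => f a).
have mc a : measurable_fun setT (fun f : field I R => f a).
  exact: field_coord_measurable.
apply: (g_sigma_algebra_measure_unique G _ (fun=> setT) _ _
  (distribution P (mfun_Sub (mem_set mfX)))
  (distribution P' (mfun_Sub (mem_set mfX')))).
- by move=> C; exact: cylinder_sub_measurable.
- by move=> _; exact: cylinderT.
- by rewrite bigcup_const.
- exact: cylinder_setI_closed.
- move=> _ [J [A [uJ mA _ AJ ->]]].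
  have := cylinder_prob iX uJ mA AJ.
  have := cylinder_prob iX' uJ mA AJ.
  rewrite /distribution /pushforward /= => e' e.
  rewrite [LHS]e [RHS]e'.
  by apply: eq_bigr => a _; exact: XX'.
- by move=> _; rewrite ltey_eq fin_num_measure.
- by apply: sigma_of_cylinder; exact: field_sigma_of.
Qed.

(** * Second moments and independence *)

Section second_moments.
Context d (T : measurableType d) (R : realType) (P : probability T R).
Implicit Types (f g X Y : T -> R) (A : set T).

Lemma Lfun_measurable p f : f \in Lfun P p -> measurable_fun setT f.
Proof. by rewrite inE => /andP[/[!inE]]. Qed.

Lemma Lfun2P f : f \in Lfun P 2%:E <->
  measurable_fun setT f /\ P.-integrable setT (fun x => (f x ^+ 2)%:E).
Proof.
split=> [lf|[mf intf]].
  by split; [exact: Lfun_measurable lf|exact: Lfun2_integrable_sqr].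
rewrite inE; apply/andP; split; rewrite inE //= /finite_norm unlock /Lnorm.
rewrite poweR_lty //.
have -> : (\int[P]_x `|(EFin \o f) x| `^ 2 = \int[P]_x (f x ^+ 2)%:E)%E.
  apply: eq_integral => x _.
  by rewrite /= powR_mulrn ?normr_ge0 // real_normK ?num_real.
exact: integrable_lty.
Qed.

Lemma Lfun2D f g : f \in Lfun P 2%:E -> g \in Lfun P 2%:E ->
  (fun x => f x + g x) \in Lfun P 2%:E.
Proof.
move=> f2 g2.
exact: (LfunP (Lfun_Sub (lee1n 2) f2 + Lfun_Sub (lee1n 2) g2)).
Qed.

Lemma Lfun2Zl f (c : R) : f \in Lfun P 2%:E -> (fun x =>
  c * f x) \in Lfun P 2%:E.
Proof.
move=> f2; have -> : (fun x => c * f x) = c \o* f.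
  by apply/funext => x; rewrite /= mulrC.
by apply: Lfun_scale => //; exact: ler1n.
Qed.

Lemma Lfun2B f g : f \in Lfun P 2%:E -> g \in Lfun P 2%:E ->
  (fun x => f x - g x) \in Lfun P 2%:E.
Proof.
move=> f2 g2; have := Lfun2D f2 (Lfun2Zl (-1) g2).
by under eq_fun do rewrite mulN1r.
Qed.

Lemma Lfun2_sum (I : Type) (s : seq I) (F : I -> T -> R) :
  (forall i, F i \in Lfun P 2%:E) -> (fun x =>
    \sum_(i <- s) F i x) \in Lfun P 2%:E.
Proof.
move=> F2; elim: s => [|i s IH].
  under eq_fun do rewrite big_nil.
  exact: (Lfun_cst P 0 2).
by under eq_fun do rewrite big_cons; exact: Lfun2D.
Qed.

Lemma Lfun2M_indic f A : measurable A -> f \in Lfun P 2%:E ->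
  (fun x => f x * \1_A x) \in Lfun P 2%:E.
Proof.
move=> mA /Lfun2P[mf intf].
have mg : measurable_fun setT (fun x => f x * \1_A x).
  by apply: measurable_funM => //; exact: measurable_indic.
apply/Lfun2P; split => //; apply: le_integrable intf => //.
  by apply/measurable_EFinP; exact: measurable_funX.
move=> x _; rewrite !abse_EFin lee_fin !normrX normrM ler_pXn2r ?nnegrE
  ?mulr_ge0 //.
by rewrite ler_piMr // indicE; case: (_ \in _); rewrite ?normr1 ?normr0.
Qed.

Lemma Lfun2_Lfun1 f : f \in Lfun P 2%:E -> f \in Lfun P 1.
Proof. by apply: Lfun_subset12; exact: fin_num_measure. Qed.

Lemma Lfun1_integrableE f : f \in Lfun P 1 -> P.-integrable setT (fun x =>
  (f x)%:E).
Proof. by move=> /Lfun1_integrable. Qed.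

Lemma Lfun2_integrableM f g : f \in Lfun P 2%:E -> g \in Lfun P 2%:E ->
  P.-integrable setT (fun x => (f x * g x)%:E).
Proof. by move=> f2 g2; apply: Lfun1_integrableE; exact: Lfun2_mul_Lfun1. Qed.

End second_moments.

Section independent_pairs.
Context (R : realType) d (T : measurableType d) (P : probability T R)
  d1 (S1 : measurableType d1) d2 (S2 : measurableType d2)
  (U : T -> S1) (V : T -> S2).
Hypotheses (mU : measurable_fun setT U) (mV : measurable_fun setT V)
  (UV : forall A B, measurable A -> measurable B ->
    (P (U @^-1` A `&` V @^-1` B) = P (U @^-1` A) * P (V @^-1` B))%E).

Let PU := distribution P (mfun_Sub (mem_set mU)).
Let PV := distribution P (mfun_Sub (mem_set mV)).

Let mUV : measurable_fun setT (fun x => (U x, V x)).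
Proof. exact: measurable_fun_pair. Qed.

Lemma indep_pair_law (C : set (S1 * S2)) : measurable C ->
  P ((fun x => (U x, V x)) @^-1` C) = (PU \x PV)%E C.
Proof.
move=> mC.
rewrite (@product_measure_unique _ _ _ _ _ _ _
  (distribution P (mfun_Sub (mem_set mUV)))) //.
Qed.

Lemma indep_pair_integral (f : S1 * S2 -> \bar R) :
  measurable_fun setT f -> (forall z, 0 <= f z)%E ->
  (\int[P]_x f (U x, V x) = \int[P]_x \int[P]_y f (U x, V y))%E.
Proof.
move=> mf f0.
transitivity (\int[distribution P (mfun_Sub (mem_set mUV))]_z f z)%E.
  by rewrite ge0_integral_pushforward.
rewrite (eq_measure_integral (PU \x PV)%E); last first.
  by move=> C mC _; exact: indep_pair_law.
rewrite fubini_tonelli1 //.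
rewrite ge0_integral_pushforward //=.
- apply: eq_integral => x _ /=.
  rewrite /fubini_F ge0_integral_pushforward //.
  exact: measurableT_comp.
- by apply: measurable_fun_fubini_tonelli_F.
- by move=> x _; exact: integral_ge0.
Qed.

End independent_pairs.

Lemma integrable_distribution (R : realType) d (T : measurableType d)
    (P : probability T R) d' (S : measurableType d') (X : {mfun T >-> S})
    (f : S -> \bar R) : measurable_fun setT f ->
  P.-integrable setT (f \o X) -> (distribution P X).-integrable setT f.
Proof.
move=> mf /integrableP[_ intf]; apply/integrableP; split => //.
rewrite ge0_integral_pushforward //; exact: measurableT_comp.
Qed.

(** Tonelli applied to |xy| gives integrability of the product first; only then can Fubini factor
    the signed integral. *)
Lemma indep_integralM (R : realType) d (T : measurableType d)
    (P : probability T R) (X Y : T -> R) :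
  X \in Lfun P 1 -> Y \in Lfun P 1 ->
  (forall A B, measurable A -> measurable B ->
    (P (X @^-1` A `&` Y @^-1` B) = P (X @^-1` A) * P (Y @^-1` B))%E) ->
  P.-integrable setT (fun x => (X x * Y x)%:E) /\
  (\int[P]_x (X x * Y x)%:E = (\int[P]_x (X x)%:E) * (\int[P]_x (Y x)%:E))%E.
Proof.
move=> X1 Y1 XY.
have mX := Lfun_measurable X1; have mY := Lfun_measurable Y1.
have mXY : measurable_fun setT (fun x =>
  (X x, Y x)) by exact: measurable_fun_pair.
pose PX := distribution P (mfun_Sub (mem_set mX)).
pose PY := distribution P (mfun_Sub (mem_set mY)).
pose f (z : R * R) := (z.1 * z.2)%:E.
have mf : measurable_fun setT f.
  by apply/measurable_EFinP; apply: measurable_funM.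
have mabsf : measurable_fun setT (fun z => `|f z|%E) by exact: measurableT_comp.
have intXY : P.-integrable setT (fun x => (X x * Y x)%:E).
  apply/integrableP; split.
    by apply/measurable_EFinP; apply: measurable_funM.
  rewrite (_ : (\int[P]_x _ = \int[P]_x `|f (X x, Y x)|)%E) //.
  rewrite (indep_pair_integral mX mY XY (f := fun z => `|f z|%E)) //.
  have aY y : (0 <= `|(Y y)%:E|)%E by [].
  have -> : (\int[P]_x \int[P]_y `|f (X x, Y y)| =
      \int[P]_x (`|(X x)%:E| * \int[P]_y `|(Y y)%:E|))%E.
    apply: eq_integral => x _; rewrite -ge0_integralZl //.
      by apply: eq_integral => y _; rewrite /f /= -!abse_EFin EFinM abseM.
    by apply: measurableT_comp => //; exact/measurable_EFinP.
  rewrite ge0_integralZr //; last 2 first.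
  - by apply: measurableT_comp => //; exact/measurable_EFinP.
  - exact: integral_ge0.
  have /integrableP[_ X1'] := Lfun1_integrableE X1.
  have /integrableP[_ Y1'] := Lfun1_integrableE Y1.
  by rewrite lte_mul_pinfty // ?integral_ge0 // ge0_fin_numE // integral_ge0.
split=> //.
have lawE (D : set (R * R)) : measurable D -> D `<=` setT ->
    distribution P (mfun_Sub (mem_set mXY)) D = (PX \x PY)%E D.
  by move=> mD _; exact: (indep_pair_law mX mY XY).
have intf : (PX \x PY)%E.-integrable setT f.
  apply/integrableP; split => //.
  rewrite -(eq_measure_integral _ lawE) ge0_integral_pushforward //.
  by case/integrableP: intXY.
have -> : (\int[P]_x (X x * Y x)%:E = \int[PX \x PY]_z f z)%E.
  by rewrite -(eq_measure_integral _ lawE) integral_pushforward.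
rewrite -fubini1 //.
have intY : P.-integrable setT (fun x => (Y x)%:E) by exact: Lfun1_integrableE.
have EYE : (\int[P]_x (Y x)%:E = (fine (\int[P]_x (Y x)%:E))%:E)%E.
  by rewrite fineK //; exact: integrable_fin_num.
have -> : (\int[PX]_x fubini_F PY f x =
    \int[PX]_x (x%:E * (fine (\int[P]_x (Y x)%:E))%:E))%E.
  apply: eq_integral => x _; rewrite -EYE /fubini_F /f /=.
  under eq_integral => y _ do rewrite EFinM.
  rewrite integralZl //; first by rewrite integral_pushforward.
  exact: integrable_distribution.
have intX : P.-integrable setT (fun x => (X x)%:E) by exact: Lfun1_integrableE.
rewrite integralZr //; last exact: integrable_distribution.
by rewrite -EYE integral_pushforward.
Qed.

(** * Convergence of orthogonal increments *)

Lemma integral_mul_indic d (T : measurableType d) (R : realType)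
    (P : probability T R) (f : T -> R) (A : set T) :
  (\int[P]_(x in A) (f x)%:E = \int[P]_x (f x * \1_A x)%:E)%E.
Proof.
rewrite integral_mkcond; apply: eq_integral => x _.
by rewrite patchE indicE; case: ifP; rewrite ?mulr1 ?mulr0.
Qed.

(** Adaptedness becomes measurability on the space generated by [G], where the closure lemmas for
    sums, products and limits apply. *)
Lemma adapted_measurableP d (T : measurableType d) (R : realType)
    (G : set (set T)) (f : T -> R) : sigma_algebra setT G ->
  (forall B : set R, measurable B -> G (f @^-1` B)) <->
  measurable_fun (setT : set (g_sigma_algebraType G)) f.
Proof.
move=> sG; have GE := sigma_algebra_id sG.
split=> [fG _ B mB|mf B mB].
  by rewrite setTI /measurable /= GE; exact: fG.
by have := mf measurableT B mB; rewrite setTI /measurable /= GE.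
Qed.

(* The total function [limf] agrees with the limit of a convergent sequence, and
   unlike a limit it depends measurably on the sequence everywhere. *)
Definition limf (R : realType) (u : nat -> R) : R :=
  fine (limn_esup (fun n => (u n)%:E)).

Lemma limf_cvg (R : realType) (u : nat -> R) (l : R) :
  u n @[n --> \oo] --> l -> limf u = l.
Proof.
move=> ul; rewrite /limf (cvg_limn_einf_sup (l := l%:E)) //.
by apply: cvg_EFin => //; exact: nearW.
Qed.

Lemma measurable_limf d (T : measurableType d) (R : realType)
    (S : nat -> T -> R) : (forall n, measurable_fun setT (S n)) ->
  measurable_fun setT (fun x => limf (S^~ x)).
Proof.
move=> mS; apply: (@measurableT_comp _ _ _ _ _ _ fine).
  exact: fine_measurable.
apply: (@measurable_fun_limn_esup _ _ _ _ (fun n x => (S n x)%:E)) => n.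
exact/measurable_EFinP.
Qed.

Section orthogonal_increments.
Context d (T : measurableType d) (R : realType) (P : probability T R)
  (F : nat -> set (set T)) (S : nat -> T -> R) (v : nat -> R).
Hypotheses (fF : is_filtration F)
  (SF : forall n (B : set R), measurable B -> F n (S n @^-1` B))
  (S2 : forall n, S n \in Lfun P 2%:E)
  (orth : forall m n (Z : T -> R), (m <= n)%N ->
     (forall B : set R, measurable B -> F m (Z @^-1` B)) -> Z \in Lfun P 2%:E ->
     (\int[P]_x ((S n x - S m x) * Z x)%:E = 0)%E)
  (Sv : forall m n, (m <= n)%N ->
     (\int[P]_x ((S n x - S m x) ^+ 2)%:E <= (v m)%:E)%E)
  (v0 : v n @[n --> \oo] --> 0).

(** [seqDU] of these events sorts the paths by the first time they leave the ball of radius [e]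
    around their value at time [m], the decomposition behind Kolmogorov's inequality. *)
Let exceed m e j := [set x | e <= `|S (m + j)%N x - S m x|].

Let SFT m n : (m <= n)%N ->
  measurable_fun (setT : set (g_sigma_algebraType (F n))) (S m).
Proof.
move=> mn; have [sF _ FS] := fF.
by apply/(adapted_measurableP _ (sF n)) => B mB; apply: (FS m n mn); exact: SF.
Qed.

Let F_exceed m e j n : (m + j <= n)%N -> F n (exceed m e j).
Proof.
move=> mjn; have [sF _ FS] := fF.
rewrite -(sigma_algebra_id (sF n)).
have : measurable_fun (setT : set (g_sigma_algebraType (F n)))
    (fun x => `|S (m + j)%N x - S m x|).
  apply: measurableT_comp => //; apply: measurable_funB; apply: SFT => //.
  exact: leq_trans (leq_addr _ _) mjn.
move=> /(_ measurableT `[e, +oo[%classic (measurable_itv _)).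
rewrite setTI; congr (measurable _); apply/seteqP; split => x;
by rewrite /exceed /= in_itv /= andbT.
Qed.

Let F_first_exceed m e j : F (m + j)%N (seqDU (exceed m e) j).
Proof.
have [sF _ FS] := fF.
rewrite -(sigma_algebra_id (sF (m + j)%N)).
apply: (@measurableD _ (g_sigma_algebraType (F (m + j)%N))).
  by rewrite /measurable /= sigma_algebra_id //; exact: F_exceed.
apply: bigsetU_measurable => i _.
rewrite /measurable /= sigma_algebra_id //; apply: F_exceed.
by rewrite leq_add2l ltnW.
Qed.

Let mSB m n : measurable_fun setT (fun x => S n x - S m x).
Proof. by apply: measurable_funB; apply: (@Lfun_measurable _ _ _ P 2%:E). Qed.

(** Split S_n - S_m at time m + j and expand the square. The cross term integrates to 0 by [orth],
    since the first exceedance is decided at time m + j; the square of the later increment is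
    dropped; the earlier one is at least e^2 on the event. *)
Let first_exceed_le m e j n : 0 < e -> (m + j <= n)%N ->
  ((e ^+ 2)%:E * P (seqDU (exceed m e) j) <=
   \int[P]_(x in seqDU (exceed m e) j) ((S n x - S m x) ^+ 2)%:E)%E.
Proof.
move=> e0 mjn; set A := seqDU _ _; have [sF Fm FS] := fF.
have mA : measurable A by apply: (Fm (m + j)%N); exact: F_first_exceed.
pose Z x := (S (m + j)%N x - S m x) * \1_A x.
have Z2 : Z \in Lfun P 2%:E by apply: Lfun2M_indic => //; exact: Lfun2B.
have Y2 : (fun x => S n x - S (m + j)%N x) \in Lfun P 2%:E by exact: Lfun2B.
have ZF (B : set R) : measurable B -> F (m + j)%N (Z @^-1` B).
  move: B; apply/adapted_measurableP => //.
  apply: measurable_funM; first by apply: measurable_funB; apply: SFT => //;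
    exact: leq_addr.
  apply: measurable_indic.
  by rewrite /measurable /= sigma_algebra_id //; exact: F_first_exceed.
have intYZ := Lfun2_integrableM Y2 Z2.
have intA : P.-integrable setT (fun x => (e ^+ 2 * \1_A x)%:E).
  under eq_fun do rewrite EFinM.
  by apply: integrableZl => //; exact: integrable_indic.
have intYZ2 : P.-integrable setT
    (fun x => (2 * ((S n x - S (m + j)%N x) * Z x))%:E).
  by under eq_fun do rewrite EFinM; exact: integrableZl.
have -> : ((e ^+ 2)%:E * P A = \int[P]_x
    (e ^+ 2 * \1_A x + 2 * ((S n x - S (m + j)%N x) * Z x))%:E)%E.
  under eq_integral do rewrite EFinD.
  rewrite integralD //.
  under [X in (_ = _ + X)%E]eq_integral do rewrite EFinM.
  rewrite integralZl // orth // ?mule0 ?adde0.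
  under eq_integral do rewrite EFinM.
  by rewrite integralZl ?integral_indic ?setIT //; exact: integrable_indic.
rewrite [leRHS]integral_mul_indic; apply: le_integral => //.
- by under eq_fun do rewrite EFinD; exact: integrableD.
- have /Lfun2P[_ ] : (fun x => (S n x - S m x) * \1_A x) \in Lfun P 2%:E.
    by apply: Lfun2M_indic => //; exact: Lfun2B.
  apply: eq_integrable => // x _; rewrite exprMn indicE.
  by case: (_ \in _); rewrite ?expr1n ?expr0n.
move=> x _; rewrite lee_fin /Z indicE.
have [/set_mem[+ _]|_] := boolP (x \in A); last by rewrite !mulr0 addr0.
rewrite /exceed /= !mulr1 => ea.
have : e ^+ 2 <= (S (m + j)%N x - S m x) ^+ 2.
  by rewrite -(real_normK (num_real (_ - _))) lerXn2r ?nnegrE // ltW.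
move=> e2; have -> : (S n x - S m x) ^+ 2 = (S (m + j)%N x - S m x) ^+ 2 +
  2 * ((S n x - S (m + j)%N x) * (S (m + j)%N x - S m x)) +
  (S n x - S (m + j)%N x) ^+ 2 by ring.
by rewrite -[leLHS]addr0 lerD ?sqr_ge0 // lerD2r.
Qed.

(** The first exceedances are disjoint, and the previous bound holds for all of them with the same
    final time m + N, so the integrals add up to at most the total second moment. *)
Let maximal m e N : 0 < e ->
  ((e ^+ 2)%:E * P (\big[setU/set0]_(j < N) exceed m e j) <= (v m)%:E)%E.
Proof.
move=> e0; have [_ Fm _] := fF.
have mA j : measurable (seqDU (exceed m e) j).
  by apply: (Fm (m + j)%N); exact: F_first_exceed.
rewrite bigsetU_seqDU (measure_bigsetU _ mA (trivIset_seqDU _)).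
rewrite ge0_sume_distrr; last by move=> j _; exact: measure_ge0.
apply: le_trans (Sv (leq_addr N m)).
have mS : measurable_fun setT (fun x => ((S (m + N)%N x - S m x) ^+ 2)%:E).
  by apply/measurable_EFinP; exact: measurable_funX.
apply: (@le_trans _ _ (\int[P]_(x in \big[setU/set0]_(j < N)
    seqDU (exceed m e) j) ((S (m + N)%N x - S m x) ^+ 2)%:E)%E).
  rewrite -(big_mkord xpredT (seqDU (exceed m e))) ge0_integral_bigsetU //=.
  - rewrite big_mkord; apply: lee_sum => j _.
    by apply: first_exceed_le => //; rewrite leq_add2l ltnW.
  - exact: iota_uniq.
  - by apply: sub_trivIset (trivIset_seqDU (exceed m e)).
  - exact: measurable_funTS.
  - by move=> x _; rewrite lee_fin sqr_ge0.
apply: ge0_subset_integral => //.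
- by apply: bigsetU_measurable => j _.
- by move=> x _; rewrite lee_fin sqr_ge0.
Qed.

Let exceed_le m e : 0 < e ->
  (P (\bigcup_j exceed m e j) <= (v m / e ^+ 2)%:E)%E.
Proof.
move=> e0; have [_ Fm _] := fF.
have mE j : measurable (exceed m e j).
  by apply: (Fm (m + j)%N); exact: F_exceed.
rewrite -bigcup_bigsetU_bigcup.
have cvgP : (P \o (fun k =>
  \big[setU/set0]_(j < k.+1) exceed m e j)) x @[x --> \oo]
    --> P (\bigcup_k \big[setU/set0]_(j < k.+1) exceed m e j).
  apply: nondecreasing_cvg_mu.
  - by move=> k; apply: bigsetU_measurable.
  - by apply: bigcupT_measurable => k; apply: bigsetU_measurable.
  - by move=> a b ab; apply/subsetPset; apply: subset_bigsetU.
apply: cvge_le cvgP; apply: nearW => k /=.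
rewrite EFinM lee_pdivlMr ?exprn_gt0 // muleC.
exact: maximal.
Qed.

(** [N q] gathers the paths that, after every time m, move away from S_m by at least 1/(q+1). Its
    probability is at most v m * (q+1)^2 for every m, hence 0, and a path outside all [N q] is
    Cauchy. *)
Lemma orthogonal_ae_cvg : {ae P, forall x, cvgn (S^~ x)}.
Proof.
have [_ Fm _] := fF.
have mE m e j : measurable (exceed m e j).
  by apply: (Fm (m + j)%N); exact: F_exceed.
pose N q := \bigcap_m \bigcup_j exceed m q.+1%:R^-1 j.
apply: (@negligibleS _ _ _ _ (\bigcup_q N q)); last first.
  apply: negligible_bigcup => q; apply/negligibleP.
    by apply: bigcapT_measurable => m; apply: bigcupT_measurable.
  apply/eqP; rewrite eq_le measure_ge0 andbT.
  have c0 : (v n / q.+1%:R^-1 ^+ 2)%:E @[n --> \oo] --> 0%E.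
    apply: cvg_EFin; first exact: nearW.
    by rewrite -[X in _ --> X](mul0r ((q.+1%:R^-1 ^+ 2)^-1));
      exact: cvgM v0 (cvg_cst _).
  apply: cvge_ge c0; apply: nearW => m.
  apply: le_trans (exceed_le m _); last by rewrite invr_gt0.
  apply: le_measure; rewrite ?inE;
    [|exact: bigcupT_measurable|exact: bigcap_inf].
  by apply: bigcapT_measurable => k; apply: bigcupT_measurable.
move=> x; apply: contra_notP => Nx; apply/cauchy_cvgP;
  apply: cauchy_exP => e e0.
have [q qe] : exists q, q.+1%:R^-1 < e.
  have [q _ qe] := near_infty_natSinv_lt (PosNum e0).
  by exists q; exact: (qe q (leqnn q)).
have /existsNP[m /not_implyP[_ Nm]] : ~ N q x by move=> ?; apply: Nx; exists q.
exists (S m x); exists m => // n /= mn.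
rewrite /ball /=; apply: lt_trans qe; rewrite ltNge; apply/negP => qS.
by apply: Nm; exists (n - m)%N => //; rewrite /exceed /= subnKC // distrC.
Qed.

Let D x := limf (S^~ x).

Let mD : measurable_fun setT D.
Proof. by apply: measurable_limf => n; exact: Lfun_measurable (S2 n). Qed.

Let S_cvg : {ae P, forall x, S n x @[n --> \oo] --> D x}.
Proof.
apply: filterS orthogonal_ae_cvg => x /cvg_ex[l Sl].
by rewrite /D (limf_cvg Sl).
Qed.

(** Fatou's lemma in n: almost surely the liminf of (S_n - S_m)^2 is (D - S_m)^2, and [Sv] bounds
    the integrals uniformly in n. *)
Let integral_sqr_le m : (\int[P]_x ((D x - S m x) ^+ 2)%:E <= (v m)%:E)%E.
Proof.
pose f n x := ((S n x - S m x) ^+ 2)%:E.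
have mf n : measurable_fun setT (f n).
  by apply/measurable_EFinP; exact: measurable_funX.
have f0 n x : (0 <= f n x)%E by rewrite lee_fin sqr_ge0.
have fD : {ae P, forall x,
  setT x -> ((D x - S m x) ^+ 2)%:E = limn_einf (f^~ x)}.
  apply: filterS S_cvg => x Sx _.
  have fx : f n x @[n --> \oo] --> ((D x - S m x) ^+ 2)%:E.
    apply: cvg_EFin; first exact: nearW.
    have Y : S n x - S m x @[n --> \oo] --> D x - S m x.
      by apply: cvgB => //; exact: cvg_cst.
    exact: (cvgM Y Y).
  by rewrite (cvg_limn_einf_sup fx).
have einf0 x : (0 <= limn_einf (f^~ x))%E.
  rewrite limn_einf_lim; apply: lime_ge; first exact: is_cvg_einfs.
  by apply: nearW => n; apply: le_ereal_inf_tmp => _ [k _ <-]; exact: f0.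
rewrite (ge0_ae_eq_integral (g := fun x => limn_einf (f^~ x))) //; first last.
- by move=> x _; rewrite lee_fin sqr_ge0.
- apply: (@measurableT_comp _ _ _ _ _ _ oppe); first exact: oppe_measurable.
  apply: (@measurable_fun_limn_esup _ _ _ _ (fun n x => - f n x)%E) => n.
  exact: measurableT_comp.
- apply/measurable_EFinP; apply: measurable_funX; apply: measurable_funB => //.
  exact: Lfun_measurable (S2 m).
apply: le_trans (fatou P measurableT mf _) _; first by move=> n x _.
rewrite limn_einf_lim; apply: lime_le; first exact: is_cvg_einfs.
exists m => // n /= mn; apply: le_trans (Sv mn).
by apply: ereal_inf_lbound; exists n => /=.
Qed.

Let D2 m : (fun x => D x - S m x) \in Lfun P 2%:E.
Proof.
have mDS : measurable_fun setT (fun x => D x - S m x).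
  by apply: measurable_funB => //; exact: Lfun_measurable (S2 m).
apply/Lfun2P; split => //; apply/integrableP; split.
  by apply/measurable_EFinP; exact: measurable_funX.
under eq_integral do rewrite gee0_abs ?lee_fin ?sqr_ge0 //.
by apply: le_lt_trans (integral_sqr_le m) _; rewrite ltry.
Qed.

Lemma orthogonal_cvg_as_L2 : cvg_as_L2 P S (fun x => limf (S^~ x)).
Proof.
split; first exact: S_cvg.
  by have := Lfun2D (D2 0%N) (S2 0%N); under eq_fun do rewrite subrK.
have v_ge0 m : 0 <= v m.
  rewrite -lee_fin; apply: le_trans (integral_sqr_le m).
  by apply: integral_ge0 => x _; rewrite lee_fin sqr_ge0.
have NE m : ('N[P]_2%:E[EFin \o (S m \- D)%R] =
    (\int[P]_x ((D x - S m x) ^+ 2)%:E) `^ 2^-1)%E.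
  rewrite unlock; congr (_ `^ _)%E; apply: eq_integral => x _.
  by rewrite /= powR_mulrn ?normr_ge0 // real_normK ?num_real // -sqrrN opprB.
have Nle m : ('N[P]_2%:E[EFin \o (S m \- D)%R] <= (Num.sqrt (v m))%:E)%E.
  rewrite NE -powR12_sqrt // -poweR_EFin.
  apply: gt0_ler_poweR => //; rewrite ?in_itv /= ?leey ?andbT ?lee_fin //.
  by apply: integral_ge0 => x _; rewrite lee_fin sqr_ge0.
apply: (@squeeze_cvge _ _ _ _ (fun=> 0%E) _ (fun n => (Num.sqrt (v n))%:E)).
- by apply: nearW => n; rewrite Lnorm_ge0 Nle.
- exact: cvg_cst.
- apply: cvg_EFin; first exact: nearW.
  have := continuous_cvg _ (@sqrt_continuous R 0) v0; rewrite sqrtr0.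
  exact.
Qed.

End orthogonal_increments.

(** * Summability of the increments of the transition kernel *)

Section finitely_supported.
Context (R : realType).
Implicit Types (f g : int -> R) (a : int).

(** A sum over all of [[set: int]] takes the default value 0 when infinitely many terms are nonzero,
    so additivity and monotonicity carry this side condition. *)
Definition fin_supp f := finite_set [set j | f j != 0].

Lemma fin_suppP f : fin_supp f <-> exists A :
  {fset int}, forall j, j \notin A -> f j = 0.
Proof.
split=> [ff|[A fA]].
  exists (fset_set [set j | f j != 0]) => j;
    rewrite in_fset_set // notin_setE /=.
  by move/negP; rewrite negbK => /eqP.
apply: (@sub_finite_set _ _ [set` A]); last exact: finite_fset.
by move=> j /=; apply: contraNT => /fA ->.
Qed.

Lemma fin_suppD f g : fin_supp f -> fin_supp g -> fin_supp (fun j => f j + g j).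
Proof.
move=> /fin_suppP[A fA] /fin_suppP[B gB]; apply/fin_suppP.
exists (A `|` B)%fset => j; rewrite in_fsetU negb_or => /andP[jA jB].
by rewrite fA // gB // addr0.
Qed.

Lemma fin_supp_comp (h : int -> R -> R) f : (forall j, h j 0 = 0) ->
  fin_supp f -> fin_supp (fun j => h j (f j)).
Proof.
move=> h0 /fin_suppP[A fA]; apply/fin_suppP; exists A => j jA.
by rewrite fA.
Qed.

Lemma fin_suppN f : fin_supp f -> fin_supp (fun j => - f j).
Proof. by apply: (fin_supp_comp (h := fun _ x => - x)) => _; rewrite oppr0. Qed.

Lemma fin_suppB f g : fin_supp f -> fin_supp g -> fin_supp (fun j => f j - g j).
Proof. by move=> ff /fin_suppN; exact: fin_suppD. Qed.

Lemma fin_suppZ (c : R) f : fin_supp f -> fin_supp (fun j => c * f j).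
Proof. by apply: (fin_supp_comp (h := fun _ x => c * x)) => _;
  rewrite mulr0. Qed.

Lemma fin_suppX f : fin_supp f -> fin_supp (fun j => f j ^+ 2).
Proof. by apply: (fin_supp_comp (h := fun _ x => x ^+ 2)) => _;
  rewrite expr0n. Qed.

Lemma fin_supp_shift f a : fin_supp f -> fin_supp (fun j => f (j + a)).
Proof.
move=> /fin_suppP[A fA]; apply/fin_suppP.
exists [fset (i - a)%R | i in A]%fset => j jA; apply: fA.
apply: contra jA => jA; apply/imfsetP; exists (j + a) => //=.
by rewrite addrK.
Qed.

Lemma fin_supp_sum (I : Type) (K : seq I) (F : I -> int -> R) :
  (forall k, fin_supp (F k)) -> fin_supp (fun j => \sum_(k <- K) F k j).
Proof.
move=> fF; elim: K => [|k K IH].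
  by apply/fin_suppP; exists fset0 => j _; rewrite big_nil.
by under eq_fun do rewrite big_cons; exact: fin_suppD.
Qed.

Lemma zsumD f g : fin_supp f -> fin_supp g ->
  \sum_(j \in [set: int]) (f j + g j) =
  \sum_(j \in [set: int]) f j + \sum_(j \in [set: int]) g j.
Proof.
move=> /fin_suppP[A fA] /fin_suppP[B gB].
rewrite !(fsbigTE (A `|` B)%fset) ?big_split //= => j;
  rewrite in_fsetU negb_or => /andP[jA jB];
  by rewrite ?fA ?gB ?addr0.
Qed.

Lemma zsumZ (c : R) f :
  \sum_(j \in [set: int]) (c * f j) = c * \sum_(j \in [set: int]) f j.
Proof. by rewrite mulr_fsumr. Qed.

Lemma zsumB f g : fin_supp f -> fin_supp g ->
  \sum_(j \in [set: int]) (f j - g j) =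
  \sum_(j \in [set: int]) f j - \sum_(j \in [set: int]) g j.
Proof.
move=> ff fg; rewrite zsumD //; last exact: fin_suppN.
congr (_ + _); rewrite -mulN1r -zsumZ.
by apply: eq_fsbigr => j _; rewrite mulN1r.
Qed.

Lemma zsum_shift f a :
  \sum_(j \in [set: int]) f (j + a) = \sum_(j \in [set: int]) f j.
Proof.
rewrite [RHS](reindex_fsbigT (fun j => j + a)) //.
by exists (fun j => j - a) => j; rewrite ?addrK ?subrK.
Qed.

Lemma le_zsum f g : fin_supp f -> fin_supp g -> (forall j, f j <= g j) ->
  \sum_(j \in [set: int]) f j <= \sum_(j \in [set: int]) g j.
Proof.
move=> ff fg fleg; rewrite -subr_ge0 -zsumB //.
by apply: fsumr_ge0 => j _; rewrite subr_ge0.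
Qed.

Lemma zsum_sum (I : Type) (K : seq I) (F : I -> int -> R) :
  (forall k, fin_supp (F k)) ->
  \sum_(j \in [set: int]) (\sum_(k <- K) F k j) =
  \sum_(k <- K) \sum_(j \in [set: int]) F k j.
Proof.
move=> fF; elim: K => [|k K IH].
  by rewrite big_nil fsbig1 // => j _; rewrite big_nil.
under eq_fsbigr do rewrite big_cons.
by rewrite zsumD // ?IH ?big_cons //; exact: fin_supp_sum.
Qed.

End finitely_supported.

Section transition_kernel.
Context (R : realType) (w : int -> R).
Hypothesis hw : weight w.

Definition supp := fset_set [set k | 0 < w k].

Lemma w_ge0 k : 0 <= w k.
Proof. by have [/(_ k)/andP[]] := hw. Qed.

Lemma w_supp k : k \notin supp -> w k = 0.
Proof.
have [_ fw _] := hw; rewrite in_fset_set // notin_setE /= => /negP.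
by rewrite lt_neqAle w_ge0 andbT negbK => /eqP.
Qed.

Lemma w_supp_gt0 k : k \in supp -> 0 < w k.
Proof. by have [_ fw _] := hw; rewrite in_fset_set // => /set_mem. Qed.

Lemma sum_w : \sum_(k <- supp) w k = 1.
Proof. by have [_ _ <-] := hw; rewrite (fsbigTE supp) // => k;
  exact: w_supp. Qed.

Lemma pstepS n i j :
  pstep w n.+1 i j = \sum_(k <- supp) w k * pstep w n (i + k) j.
Proof.
rewrite /= -(zsum_shift _ i) (fsbigTE supp) //.
  by apply: eq_bigr => k _; rewrite addrK addrC.
by move=> k /w_supp; rewrite addrK => ->; rewrite mul0r.
Qed.

Lemma pstep_shift n i j a : pstep w n (i + a) (j + a) = pstep w n i j.
Proof.
elim: n i j => [|n IH] i j; first by rewrite /= (inj_eq (addIr a)).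
by rewrite !pstepS; apply: eq_bigr => k _; rewrite addrAC IH.
Qed.

Local Notation p n j := (pstep w n 0 j).

Lemma pstepE n i j : pstep w n i j = p n (j - i).
Proof. by rewrite -(pstep_shift n 0 (j - i) i) add0r subrK. Qed.

Lemma kernelS n j : p n.+1 j = \sum_(k <- supp) w k * p n (j - k).
Proof. by rewrite pstepS; apply: eq_bigr => k _; rewrite add0r pstepE. Qed.

Lemma fin_supp_kernel n : fin_supp (fun j => p n j).
Proof.
elim: n => [|n IH].
  by apply/fin_suppP; exists [fset 0]%fset => j;
    rewrite inE eq_sym => /negbTE /= ->.
under eq_fun do rewrite kernelS.
by apply: fin_supp_sum => k; apply: fin_suppZ; exact: fin_supp_shift.
Qed.

(* Jensen's inequality for the square, with the gap bounded below by a single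
   term of the variance. *)
Lemma convolution_gap f k l : k \in supp -> l \in supp -> fin_supp f ->
  w k * w l * \sum_(j \in [set: int]) (f (j - k) - f (j - l)) ^+ 2 <=
  2 * (\sum_(j \in [set: int]) f j ^+ 2 -
       \sum_(j \in [set: int]) (\sum_(k <- supp) w k * f (j - k)) ^+ 2).
Proof.
move=> kS lS ff.
have fs a : fin_supp (fun j => f (j - a)) by exact: fin_supp_shift.
have fW : fin_supp (fun j => \sum_(k <- supp) w k * f (j - k)).
  by apply: fin_supp_sum => a; exact: fin_suppZ.
have -> : \sum_(j \in [set: int]) f j ^+ 2 =
    \sum_(j \in [set: int]) \sum_(k <- supp) w k * f (j - k) ^+ 2.
  rewrite zsum_sum; last by move=> a; apply: fin_suppZ; exact: fin_suppX.
  rewrite -[LHS]mul1r -sum_w mulr_suml; apply: eq_bigr => a _.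
  by rewrite (zsumZ (w a) (fun j => f (j - a) ^+ 2))
    (zsum_shift (fun j => f j ^+ 2)).
rewrite -zsumB; last exact: fin_suppX; last first.
  by apply: fin_supp_sum => a; apply: fin_suppZ; exact: fin_suppX.
rewrite -!zsumZ; apply: le_zsum.
- by apply: fin_suppZ; apply: fin_suppX; exact: fin_suppB.
- apply: fin_suppZ; apply: fin_suppB; last exact: fin_suppX.
  by apply: fin_supp_sum => a; apply: fin_suppZ; exact: fin_suppX.
move=> j; set g := fun a => f (j - a).
(* Twice the variance of [g] under [w] is the mean squared difference of two independent copies. All
   summands are nonnegative, so the pair (k, l) can be kept alone. *)
have -> : 2 * (\sum_(a <- supp) w a * f (j - a) ^+ 2 -
    (\sum_(a <- supp) w a * f (j - a)) ^+ 2) =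
    \sum_(a <- supp) \sum_(b <- supp) w a * w b * (g a - g b) ^+ 2.
  pose m1 := \sum_(a <- supp) w a * g a;
    pose m2 := \sum_(a <- supp) w a * g a ^+ 2.
  transitivity (\sum_(a <- supp) (w a * g a ^+ 2 + w a * m2 - 2 * (w a * g a) *
    m1)).
    rewrite big_split /= big_split /= sumrN -!mulr_suml -mulr_sumr sum_w.
    by rewrite -/m1 -/m2 /m1 /m2 /g; ring.
  apply: eq_bigr => a _.
  transitivity (\sum_(b <- supp) (w a * g a ^+ 2 * w b + w a * (w b * g b ^+ 2)
    - 2 * (w a * g a) * (w b * g b))).
    by rewrite big_split /= big_split /= sumrN -!mulr_sumr sum_w mulr1.
  by apply: eq_bigr => b _; ring.
have F0 a b : 0 <= w a * w b * (g a - g b) ^+ 2.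
  by apply: mulr_ge0; [apply: mulr_ge0; exact: w_ge0|exact: sqr_ge0].
rewrite (big_fsetD1 k) //= (big_fsetD1 l) //= -addrA lerDl.
by apply: addr_ge0; do ?[apply: sumr_ge0 => ? _].
Qed.

Definition shift_energy n (m : int) :=
  \sum_(j \in [set: int]) (p n j - p n (j - m)) ^+ 2.

Lemma shift_energy_ge0 n m : 0 <= shift_energy n m.
Proof. by apply: fsumr_ge0 => j _; exact: sqr_ge0. Qed.

Definition summable_shift m :=
  exists C, forall N, \sum_(n < N) shift_energy n m <= C.

Lemma summable_shift_supp k l :
  k \in supp -> l \in supp -> summable_shift (l - k).
Proof.
(* By [convolution_gap] the energies, multiplied by w k * w l, are dominated by 2 (q_n - q_(n+1)),
   where q_n is |p^n|_2^2; the sum telescopes to at most 2 q_0 = 2. *)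
move=> kS lS; exists (2 / (w k * w l)) => N.
have wkl : 0 < w k * w l by rewrite mulr_gt0 ?w_supp_gt0.
rewrite ler_pdivlMr // mulrC mulr_sumr.
pose q n : R := \sum_(j \in [set: int]) p n j ^+ 2.
have step n : w k * w l * shift_energy n (l - k) <= 2 * (q n - q n.+1).
  rewrite /shift_energy -(zsum_shift _ (- k)).
  have := convolution_gap kS lS (fin_supp_kernel n); rewrite /q.
  under [X in _ - X]eq_fsbigr do rewrite -kernelS.
  apply: le_trans; apply: ler_wpM2l; first exact: ltW.
  rewrite le_eqVlt; apply/orP; left; apply/eqP.
  by apply: eq_fsbigr => j _; rewrite opprB addrA addrNK.
apply: le_trans (_ : \sum_(n < N) 2 * (q n - q n.+1) <= _).
  by apply: ler_sum => n _; exact: step.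
rewrite -mulr_sumr -[leRHS]mulr1 ler_pM2l //.
rewrite -(big_mkord xpredT (fun n => q n - q n.+1)).
under eq_bigr do rewrite -opprB; rewrite sumrN telescope_sumr // opprB.
have q0 : q 0%N = 1.
  rewrite /q (fsbigTE [fset 0]%fset) ?big_seq_fset1 /= ?eqxx ?expr1n //.
  by move=> j; rewrite inE eq_sym => /negbTE ->; rewrite expr0n.
by rewrite q0 lerBlDr lerDl; apply: fsumr_ge0 => j _; exact: sqr_ge0.
Qed.

(** Pass through the intermediate translate by m and use (a + b)^2 <= 2 a^2 + 2 b^2, whose defect is
    (a - b)^2; this is the origin of the bound 2C + 2C'. *)
Lemma summable_shiftD m m' :
  summable_shift m -> summable_shift m' -> summable_shift (m + m').
Proof.
move=> [C mC] [C' mC']; exists (2 * C + 2 * C') => N.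
have sup n a b : fin_supp (fun j => (p n (j + a) - p n (j + b)) ^+ 2).
  by apply: fin_suppX; apply: fin_suppB; apply: fin_supp_shift;
    exact: fin_supp_kernel.
have sup0 n b : fin_supp (fun j => (p n j - p n (j + b)) ^+ 2).
  apply: fin_suppX; apply: fin_suppB; first exact: fin_supp_kernel.
  by apply: fin_supp_shift; exact: fin_supp_kernel.
apply: le_trans (_ : \sum_(n < N) (2 * shift_energy n m + 2 * shift_energy n
  m') <= _).
  apply: ler_sum => n _.
  have -> : shift_energy n m' =
      \sum_(j \in [set: int]) (p n (j - m) - p n (j - (m + m'))) ^+ 2.
    rewrite /shift_energy -(zsum_shift _ (- m)); apply: eq_fsbigr => j _.
    by rewrite opprD addrA.
  rewrite /shift_energy -!zsumZ -zsumD; [|exact: fin_suppZ..].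
  apply: le_zsum => //; first by apply: fin_suppD; exact: fin_suppZ.
  move=> j; rewrite -subr_ge0.
  set x := p n j; set y := p n (j - m); set z := p n _.
  by rewrite (_ : _ - _ = ((x - y) - (y - z)) ^+ 2) ?sqr_ge0 //; ring.
by rewrite big_split /= -!mulr_sumr; apply: lerD;
  rewrite ler_pM2l // ?mC ?mC'.
Qed.

Lemma summable_shiftN m : summable_shift m -> summable_shift (- m).
Proof.
move=> [C mC]; exists C => N; apply: le_trans (mC N).
rewrite le_eqVlt; apply/orP; left; apply/eqP; apply: eq_bigr => n _.
rewrite /shift_energy -(zsum_shift _ (- m)); apply: eq_fsbigr => j _.
by rewrite opprK subrK -sqrrN opprB.
Qed.

Lemma summable_shift0 : summable_shift 0.
Proof.
exists 0 => N; rewrite big1 // => n _; apply: fsbig1 => j _.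
by rewrite subr0 subrr expr0n.
Qed.

Lemma summable_shiftM m (z : int) : summable_shift m -> summable_shift (z * m).
Proof.
move=> sm; have sn (n : nat) : summable_shift (n%:Z * m).
  elim: n => [|n IH]; first by rewrite mul0r; exact: summable_shift0.
  by rewrite intS mulrDl mul1r; exact: summable_shiftD.
by case: z => n //; rewrite NegzE mulNr; apply: summable_shiftN; exact: sn.
Qed.

Hypothesis hspan : span1 w.

(** Let g be the least positive summable shift. Euclidean division makes g divide every summable
    shift, in particular every difference of support points, so the support lies in l + gZ and the
    span hypothesis forces g = 1. *)
Lemma summable_shift1 : summable_shift 1.
Proof.
have [_ spanle] := hspan; have [_ fw _] := hw.
have suppE j : 0 < w j -> j \in supp by move=> wj; rewrite in_fset_set //;
  exact: mem_set.
have [l lS] : exists l, l \in supp.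
  apply: contrapT => /forallNP none.
  have /esym/eqP := sum_w; rewrite big_seq big1 ?oner_eq0 // => k kS.
  by case: (none k).
have [k [kS kl]] : exists k, k \in supp /\ k <> l.
  (* A one-point support would be contained in l + 2Z, against the maximality of 1; so two distinct
     support points exist and some positive shift is summable. *)
  apply: contrapT => /forallNP none; suff : (2 <= 1)%N by [].
  apply: spanle.
  exists l => j /suppE jS; exists 0 => //; rewrite mulr0 addr0.
  by apply: contrapT => lj; apply: (none j); split => // jl; apply: lj.
have exg : exists n : nat, `[< (0 < n)%N /\ summable_shift n%:Z >].
  exists `|k - l|%N; apply/asboolP; split.
    by rewrite absz_gt0 subr_eq0; apply/eqP.
  have := summable_shift_supp lS kS.
  by case: (k - l)%R => n //; rewrite NegzE => /summable_shiftN;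
    rewrite opprK abszN.
have [g /asboolP[g0 sg] gmin] := ex_minnP exg.
have gdvd m : summable_shift m -> (g %| m)%Z.
  move=> sm; apply/dvdz_mod0P.
  have g0Z : g%:Z != 0 by rewrite eqz_nat -lt0n.
  have := modz_ge0 m g0Z; have := ltz_pmod m (g0 : 0 < g%:Z).
  have : summable_shift (m %% g)%Z.
    rewrite /modz -mulNr; apply: summable_shiftD => //.
    exact: summable_shiftM.
  case: (m %% g)%Z => // [[//|r]] sr rg _.
  have : `[< (0 < r.+1)%N /\ summable_shift r.+1%:Z >] by apply/asboolP.
  by move=> /gmin; rewrite leqNgt -ltz_nat rg.
suff g1 : (g <= 1)%N by rewrite (_ : 1 = g%:Z) //;
  case: g g0 g1 {sg gmin gdvd} => [|[]].
apply: spanle; exists l => j /suppE jS.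
have /dvdzP[q jl] := gdvd _ (summable_shift_supp lS jS).
by exists q => //; rewrite mulrC -jl addrC subrK.
Qed.

End transition_kernel.

(** * Heights as sums of noise layers indexed by the lag *)

Section heights.
Context (R : realType) (w : int -> R).
Hypothesis hw : weight w.
Implicit Types (omega : int -> int -> R) (t i : int) (N : nat).

Local Notation p n j := (pstep w n 0 j).

(** This is the weight of the noise at lag n and site i + j in h(i) - h(i-1): that site is at
    displacement j from i and j + 1 from i - 1. *)
Definition incr_coef n (j : int) : R := p n j - p n (j + 1).

Lemma fin_supp_incr_coef n : fin_supp (incr_coef n).
Proof.
apply: fin_suppB; first exact: fin_supp_kernel.
by apply: fin_supp_shift; exact: fin_supp_kernel.
Qed.

Lemma fin_suppMl (f g : int -> R) : fin_supp g -> fin_supp (fun j => f j * g j).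
Proof. by apply: (fin_supp_comp (h := fun j x => f j * x)) => j;
  rewrite mulr0. Qed.

Lemma fin_supp_pstep n i : fin_supp (pstep w n i).
Proof.
have -> : pstep w n i = fun j => p n (j - i) by apply/funext => j;
  exact: pstepE.
by apply: fin_supp_shift; exact: fin_supp_kernel.
Qed.

(** Time is reindexed by the lag n = t - k and space by the displacement from i, so that a longer
    history only appends layers. *)
Lemma heightE omega N t i : height w omega (t - N%:Z) t i =
  \sum_(n < N) \sum_(j \in [set: int]) omega (t - n%:Z) (i + j) * p n j.
Proof.
transitivity (\sum_(j \in [set: int]) \sum_(n < N)
    omega (t - n%:Z) j * pstep w n i j).
  apply: eq_fsbigr => j _.
  rewrite (fsbig_ord _ _ (fun n : nat => omega (t - n%:Z) j * pstep w n i j)).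
  rewrite (@reindex_fsbig _ _ _ _ _ (fun n : nat => t - n%:Z) `I_N).
    apply: eq_fsbigr => n _; congr (_ * pstep _ _ _ _).
    by rewrite opprB addrC subrK absz_nat.
  split=> [n /= nN|n n' _ _ /= /addrI /oppr_inj []//|k /= /andP[k1 k2]].
    by apply/andP; split; lia.
  by exists `|t - k|%N => /=; lia.
rewrite zsum_sum; last first.
  by move=> n; apply: fin_suppMl; exact: fin_supp_pstep.
apply: eq_bigr => n _; rewrite -(zsum_shift _ i); apply: eq_fsbigr => j _.
by rewrite (pstepE hw n i) addrK (addrC j).
Qed.

Lemma height_incrE omega N t i : height_incr w omega (t - N%:Z) t i =
  \sum_(n < N) \sum_(j \in [set: int]) omega (t - n%:Z) (i + j) * incr_coef n j.
Proof.
rewrite /height_incr !heightE -sumrB; apply: eq_bigr => n _.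
rewrite -[X in _ - X](zsum_shift _ 1) -zsumB.
- apply: eq_fsbigr => j _; rewrite mulrBr.
  by rewrite (_ : i - 1 + (j + 1) = i + j) //; lia.
- by apply: fin_suppMl; exact: fin_supp_kernel.
- by apply: fin_suppMl; apply: fin_supp_shift; exact: fin_supp_kernel.
Qed.

(** Both sides start at the same time, t + 1 - (N + 1) = t - N. The layer of lag 0 is the fresh
    noise row; the others follow from the recursion of the kernel. *)
Lemma height_incrS omega N t i :
  height_incr w omega (t + 1 - N.+1%:Z) (t + 1) i =
  \sum_(k \in [set: int]) w k * height_incr w omega (t - N%:Z) t (i + k) +
  omega (t + 1) i - omega (t + 1) (i - 1).
Proof.
suff hS i' : height w omega (t + 1 - N.+1%:Z) (t + 1) i' =
    \sum_(k <- supp w) w k * height w omega (t - N%:Z) t (i' + k) + omega (t +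
      1) i'.
  rewrite (fsbigTE (supp w)); last by move=> k /(w_supp hw) ->; rewrite mul0r.
  rewrite /height_incr !hS; under [in RHS]eq_bigr do rewrite mulrBr.
  rewrite sumrB; under [X in _ - (X + _)]eq_bigr do rewrite addrAC.
  by ring.
rewrite heightE big_ord_recl addrC; congr (_ + _); last first.
  rewrite (fsbigTE [fset 0]%fset) ?big_seq_fset1 /= ?eqxx ?mulr1 ?addr0 ?subr0
    //.
  by move=> j; rewrite inE eq_sym => /negbTE ->; rewrite mulr0.
transitivity (\sum_(n < N) \sum_(k <- supp w)
    w k * \sum_(j \in [set: int]) omega (t - n%:Z) (i' + k + j) * p n j).
  apply: eq_bigr => n _; rewrite lift0.
  under eq_fsbigr do rewrite kernelS // mulr_sumr.
  rewrite zsum_sum; last first.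
    move=> k; apply: fin_suppMl; apply: fin_suppZ; apply: fin_supp_shift.
    exact: fin_supp_kernel.
  apply: eq_bigr => k _; rewrite -zsumZ -[RHS](zsum_shift _ (- k)).
  apply: eq_fsbigr => j _; rewrite (_ : t + 1 - _ = t - n%:Z); last lia.
  by rewrite (_ : i' + k + (j - k) = i' + j); [ring|lia].
rewrite exchange_big; apply: eq_bigr => k _ /=.
by rewrite heightE mulr_sumr.
Qed.

Lemma height_incr_shift omega (u v : int) N t i :
  height_incr w (fun k j => omega (k + u) (j + v)) (t - N%:Z) t i =
  height_incr w omega (t + u - N%:Z) (t + u) (i + v).
Proof.
rewrite !height_incrE; apply: eq_bigr => n _; apply: eq_fsbigr => j _.
by rewrite addrAC (addrAC i).
Qed.

Definition incr_supp n : {fset int} := fset_set [set j | incr_coef n j != 0].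

Lemma height_incr_finite omega N t i : height_incr w omega (t - N%:Z) t i =
  \sum_(n < N) \sum_(j <- incr_supp n) omega (t - n%:Z) (i + j) * incr_coef n j.
Proof.
rewrite height_incrE; apply: eq_bigr => n _;
  rewrite (fsbigTE (incr_supp n)) // => j.
rewrite in_fset_set; last exact: fin_supp_incr_coef.
by rewrite notin_setE /= => /negP; rewrite negbK => /eqP ->; rewrite mulr0.
Qed.

Lemma incr_energyE n :
  \sum_(j <- incr_supp n) incr_coef n j ^+ 2 = shift_energy w n 1.
Proof.
transitivity (\sum_(j \in [set: int]) incr_coef n j ^+ 2).
  rewrite (fsbigTE (incr_supp n)) // => j.
  rewrite in_fset_set; last exact: fin_supp_incr_coef.
  by rewrite notin_setE /= => /negP; rewrite negbK => /eqP ->; rewrite expr0n.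
rewrite /shift_energy -[RHS](zsum_shift _ 1); apply: eq_fsbigr => j _.
by rewrite addrK /incr_coef -sqrrN opprB.
Qed.

End heights.

(** * The martingale *)

Section orthogonal_sums.
Context d (T : measurableType d) (R : realType) (P : probability T R).

Lemma integral_sumM_eq0 (I : eqType) (s : seq I) (Y : I -> T -> R) (Z :
  T -> R) :
  (forall a, Y a \in Lfun P 2%:E) -> Z \in Lfun P 2%:E ->
  (forall a, a \in s -> \int[P]_x (Y a x * Z x)%:E = 0)%E ->
  (\int[P]_x ((\sum_(a <- s) Y a x) * Z x)%:E = 0)%E.
Proof.
move=> Y2 Z2; elim: s => [|a s IH] YZ.
  by rewrite integral0_eq // => x _; rewrite big_nil mul0r.
under eq_integral do rewrite big_cons mulrDl EFinD.
rewrite integralD //; last 2 first.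
- exact: Lfun2_integrableM.
- by apply: Lfun2_integrableM => //; exact: Lfun2_sum.
rewrite YZ ?mem_head // IH ?adde0 // => b bs.
by apply: YZ; rewrite in_cons bs orbT.
Qed.

Lemma integral_sum_sqr (I : eqType) (s : seq I) (Y : I -> T -> R) (v : I -> R) :
  uniq s -> (forall a, Y a \in Lfun P 2%:E) ->
  (forall a, \int[P]_x (Y a x ^+ 2)%:E = (v a)%:E)%E ->
  (forall a b, a != b -> \int[P]_x (Y a x * Y b x)%:E = 0)%E ->
  (\int[P]_x ((\sum_(a <- s) Y a x) ^+ 2)%:E = (\sum_(a <- s) v a)%:E)%E.
Proof.
move=> + Y2 Yv Y0; elim: s => [_|a s IH /= /andP[as_ us]].
  by rewrite big_nil integral0_eq // => x _; rewrite big_nil expr0n.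
have S2 : (fun x => \sum_(b <- s) Y b x) \in Lfun P 2%:E by exact: Lfun2_sum.
under eq_integral do rewrite big_cons sqrrD -mulr_natl EFinD EFinD (EFinM 2%:R).
rewrite big_cons [RHS]EFinD -(IH us) -Yv integralD //; last 2 first.
- apply: integrableD => //; first by have /Lfun2P[] := Y2 a.
  by apply: integrableZl => //; exact: Lfun2_integrableM.
- by have /Lfun2P[] := S2.
congr (_ + _)%E; rewrite integralD //; last 2 first.
- by have /Lfun2P[] := Y2 a.
- by apply: integrableZl => //; exact: Lfun2_integrableM.
rewrite integralZl //; last exact: Lfun2_integrableM.
under [X in (_ + _ * X)%E]eq_integral do rewrite mulrC.
rewrite integral_sumM_eq0 ?mule0 ?adde0 // => b bs; apply: Y0.
by apply: contraNneq as_ => <-.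
Qed.

End orthogonal_sums.

Section noise_moments.
Context (R : realType) d (T : measurableType d) (P : probability T R)
  (xi : int -> int -> {RV P >-> R}) (mu : probability R R).
Hypothesis hxi : noise xi mu.

Definition site (a : int * int) (x : T) : R := xi a.1 a.2 x.

Lemma measurable_site a : measurable_fun setT (site a).
Proof. exact: measurable_funPT. Qed.

Lemma site_indep : mutually_independent P site.
Proof. by have [[]] := hxi. Qed.

Lemma site_mean a : (\int[P]_x (site a x)%:E = 0)%E.
Proof. by have [_ _ + _] := hxi => /(_ a.1 a.2); rewrite unlock. Qed.

Lemma site_L2 a : site a \in Lfun P 2%:E.
Proof.
apply/Lfun2P; split; first exact: measurable_site.
have [_ _ E0 /(_ a.1 a.2)] := hxi; rewrite /variance unlock E0 => V.
apply/integrableP; split.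
  by apply/measurable_EFinP; apply: measurable_funX; exact: measurable_site.
under eq_integral do rewrite gee0_abs ?lee_fin ?sqr_ge0 //.
move: V; rewrite unlock; apply: le_lt_trans; rewrite le_eqVlt; apply/orP; left.
apply/eqP; apply: eq_integral => x _;
  rewrite /site -[in LHS](subr0 (xi a.1 a.2 x)) expr2.
by [].
Qed.

Definition noise_var : R := fine (\int[mu]_x (x ^+ 2)%:E)%E.

Lemma site_sqr a : (\int[P]_x (site a x ^+ 2)%:E = noise_var%:E)%E.
Proof.
have [[_ law] _ _ _] := hxi.
have mX2 : measurable_fun setT (fun x : R => (x ^+ 2)%:E).
  by apply/measurable_EFinP; exact: exprn_measurable.
have E : (\int[P]_x (site a x ^+ 2)%:E = \int[mu]_x (x ^+ 2)%:E)%E.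
  have lawE (A : set R) : measurable A -> A `<=` setT ->
    distribution P (xi a.1 a.2) A = mu A by move=> mA _; exact: law.
  rewrite -(eq_measure_integral _ lawE).
  by rewrite ge0_integral_pushforward // => x _; rewrite lee_fin sqr_ge0.
rewrite /noise_var -E fineK //.
have /Lfun2P[_ ] := site_L2 a; exact: integrable_fin_num.
Qed.

Lemma noise_var_ge0 : 0 <= noise_var.
Proof. by apply: fine_ge0; apply: integral_ge0 => x _;
  rewrite lee_fin sqr_ge0. Qed.

Lemma site_orthogonal a (K : set (int * int)) (Z : T -> R) : ~ K a ->
  (forall B : set R, measurable B -> sigma_of K site (Z @^-1` B)) ->
  Z \in Lfun P 2%:E -> (\int[P]_x (site a x * Z x)%:E = 0)%E.
Proof.
move=> Ka ZK Z2.
have [||A B mA mB|_ ->] := indep_integralM (P := P) (X := site a) (Y := Z).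
- exact/Lfun2_Lfun1/site_L2.
- exact: Lfun2_Lfun1.
- apply: (sigma_of_indep measurable_site site_indep (K := [set a]) (L := K)).
  + by apply/seteqP; split => // b [->].
  + by apply: sub_gen_smallest; exists a => //; exists A => //; rewrite setTI.
  + exact: ZK.
by rewrite site_mean mul0e.
Qed.

End noise_moments.

Section height_martingale.
Context (R : realType) (w : int -> R) d (T : measurableType d)
  (P : probability T R) (xi : int -> int -> {RV P >-> R}) (mu :
    probability R R).
Hypotheses (hw : weight w) (hspan : span1 w) (hxi : noise xi mu).
Variables (t i : int).

Let M n x := height_incr w (fun k j => xi k j x) (t - n%:Z) t i.

Let window n := [set a : int * int | t - n%:Z < a.1 <= t].

Let Y (a : nat * int) (x : T) : R :=
  incr_coef w a.1 a.2 * site xi (t - a.1%:Z, i + a.2) x.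

(** Flattening the layers m <= k < n into one list of pairs (lag, displacement) makes each
    martingale increment a single sum of pairwise orthogonal terms. *)
Let block m n := [seq (k, j) | k <- index_iota m n, j <- incr_supp w k].

Let block_uniq m n : uniq (block m n).
Proof.
apply: allpairs_uniq_dep; [exact: iota_uniq|by move=> k _; exact: fset_uniq|].
by move=> [k j] [k' j'] _ _ /= [-> ->].
Qed.

Let ME n x : M n x = \sum_(a <- block 0 n) Y a x.
Proof.
rewrite /M height_incr_finite // big_allpairs_dep big_mkord.
by apply: eq_bigr => k _; apply: eq_bigr => j _; rewrite mulrC.
Qed.

Let MB m n x : (m <= n)%N -> M n x - M m x = \sum_(a <- block m n) Y a x.
Proof.
move=> mn; rewrite !ME !big_allpairs_dep (big_cat_nat (leq0n m) mn) /=.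
by rewrite addrAC subrr add0r.
Qed.

Let Y2 a : Y a \in Lfun P 2%:E.
Proof. by apply: Lfun2Zl; exact: (site_L2 hxi). Qed.

Let M2 n : M n \in Lfun P 2%:E.
Proof.
have -> : M n = fun x => \sum_(a <- block 0 n) Y a x by apply/funext => x;
  exact: ME.
exact: Lfun2_sum.
Qed.

Lemma past_noise_filtration : is_filtration (past_noise xi t).
Proof.
split=> [n|n|m n mn].
- exact: smallest_sigma_algebra.
- exact: sigma_of_measurable (measurable_site xi).
- by apply: sigma_of_sub => a /= /andP[a1 ->]; rewrite andbT; lia.
Qed.

Let M_adapted n (B : set R) : measurable B -> past_noise xi t n (M n @^-1` B).
Proof.
move: B; apply/adapted_measurableP; first exact: smallest_sigma_algebra.
have -> : M n = fun x => \sum_(k < n) \sum_(j <- incr_supp w k)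
    site xi (t - k%:Z, i + j) x * incr_coef w k j.
  by apply/funext => x; exact: height_incr_finite.
apply: measurable_sum => k; apply: measurable_sum => j.
apply: measurable_funM => //; apply/adapted_measurableP.
  exact: smallest_sigma_algebra.
move=> B mB; apply: sub_gen_smallest; exists (t - k%:Z, i + j).
  by rewrite /=; have := ltn_ord k; lia.
by exists B => //; rewrite setTI.
Qed.

Let M_orth m n (Z : T -> R) : (m <= n)%N ->
  (forall B : set R, measurable B -> past_noise xi t m (Z @^-1` B)) ->
  Z \in Lfun P 2%:E -> (\int[P]_x ((M n x - M m x) * Z x)%:E = 0)%E.
Proof.
move=> mn ZF Z2; under eq_integral do rewrite MB //.
apply: integral_sumM_eq0 => // -[k j] /allpairsPdep[k' [j' [+ _ [kE _]]]].
rewrite mem_index_iota -{}kE => /andP[mk _].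
under eq_integral do rewrite -mulrA EFinM.
rewrite integralZl //; last first.
  by apply: Lfun2_integrableM => //; exact: (site_L2 hxi).
rewrite (site_orthogonal hxi (K := window m)) ?mule0 //=.
by move=> /andP[] /=; lia.
Qed.

Let e k := shift_energy w k 1.

Let block_sqr m n : (m <= n)%N -> (\int[P]_x ((M n x - M m x) ^+ 2)%:E =
  (noise_var mu * \sum_(m <= k < n) e k)%:E)%E.
Proof.
move=> mn; under eq_integral do rewrite MB //.
rewrite (integral_sum_sqr (v := fun a =>
  incr_coef w a.1 a.2 ^+ 2 * noise_var mu)) //.
- congr (_%:E); rewrite big_allpairs_dep mulr_sumr; apply: eq_bigr => k _ /=.
  by rewrite -mulr_suml incr_energyE // mulrC.
- move=> a; under eq_integral do rewrite exprMn EFinM.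
  rewrite integralZl //; first by rewrite (site_sqr hxi).
  by have /Lfun2P[] := site_L2 hxi (t - a.1%:Z, i + a.2).
- move=> a b ab.
  under eq_integral do rewrite -mulrA EFinM.
  rewrite integralZl //; last first.
    by apply: Lfun2_integrableM => //; exact: (site_L2 hxi).
  rewrite (site_orthogonal hxi (K := [set (t - b.1%:Z, i + b.2)])) ?mule0 //=.
    case=> /addrI /oppr_inj [ab1] /addrI ab2; case/negP: ab; apply/eqP.
    by case: a b ab1 ab2 => [? ?] [? ?] /= -> ->.
  apply/adapted_measurableP; first exact: smallest_sigma_algebra.
  apply: measurable_funM => //; apply/adapted_measurableP.
    exact: smallest_sigma_algebra.
  move=> B mB; apply: sub_gen_smallest.
  by exists (t - b.1%:Z, i + b.2) => //; exists B => //; rewrite setTI.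
Qed.

(** The conditional expectation identity over [A] is [M_orth] with Z the indicator of [A]. *)
Lemma height_incr_martingale : L2_martingale P (past_noise xi t) M.
Proof.
split; [exact: past_noise_filtration|exact: M2|move=> m n mn].
split; [exact: M_adapted|exact/Lfun2_Lfun1/M2|move=> A FA].
have mA : measurable A by apply: sigma_of_measurable FA; exact: measurable_site.
have F1 (B : set R) : measurable B -> past_noise xi t m (\1_A @^-1` B).
  move: B; apply/adapted_measurableP; first exact: smallest_sigma_algebra.
  apply: measurable_indic; rewrite /measurable /= sigma_algebra_id //.
  exact: smallest_sigma_algebra.
have A2 : (\1_A : T -> R) \in Lfun P 2%:E.
  have := Lfun2M_indic mA (Lfun_cst P 1 2).
  by under eq_fun do rewrite mul1r.
have := M_orth mn F1 A2;
  rewrite (integral_mul_indic P (M m)) (integral_mul_indic P (M n)).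
under eq_integral do rewrite mulrBl EFinB.
have iM k : P.-integrable setT (fun x =>
  (M k x * \1_A x)%:E) by exact: Lfun2_integrableM.
rewrite integralB // => /eqP; rewrite sube_eq ?add0e => [/eqP -> //||].
- exact: integrable_fin_num.
- by rewrite fin_num_adde_defl //; exact: integrable_fin_num.
Qed.

Lemma height_incr_cvg : cvg_as_L2 P M (fun x => limf (M^~ x)).
Proof.
have [C eC] := summable_shift1 hw hspan.
pose E n := \sum_(0 <= k < n) e k.
have e0 k : 0 <= e k by exact: shift_energy_ge0.
have Einc : nondecreasing_seq E.
  by apply/nondecreasing_seqP => n; rewrite /E big_nat_recr //= lerDl.
have Ecvg : cvgn E.
  apply: nondecreasing_is_cvgn => //; exists C => _ [n _ <-].
  by rewrite /E big_mkord.
(* The bound [v m] is the noise variance times the tail of the energy series from lag m on; it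
   dominates all later increments and tends to 0. *)
apply: (@orthogonal_cvg_as_L2 _ T R P (past_noise xi t) M
  (fun m => noise_var mu * (limn E - E m))
  past_noise_filtration M_adapted M2 M_orth).
- move=> m n mn; rewrite block_sqr // lee_fin ler_wpM2l ?noise_var_ge0 //.
  rewrite lerBrDl -(big_cat_nat (leq0n m) mn) /=.
  exact: nondecreasing_cvgn_le.
- rewrite -[X in _ --> X](mulr0 (noise_var mu)) -(subrr (limn E)).
  by apply: cvgM; [exact: cvg_cst|apply: cvgB => //; exact: cvg_cst].
Qed.

End height_martingale.

(** * Almost sure equality and approximation of events *)

Section almost_everywhere.
Context d (T : measurableType d) (R : realType) (P : probability T R).

Lemma ae_forall_countable (I : countType) (Q : I -> T -> Prop) :
  (forall i, {ae P, forall x, Q i x}) -> {ae P, forall x, forall i, Q i x}.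
Proof.
move=> Qae.
pose N n := if @choice.unpickle I n is Some i then ~` [set x | Q i x] else set0.
apply: (@negligibleS _ _ _ _ (\bigcup_n N n)); last first.
  apply: negligible_bigcup => n; rewrite /N; case: choice.unpickle => [i|].
    exact: Qae.
  exact: negligible_set0.
move=> x /= /existsNP[i Qi]; exists (choice.pickle i) => //.
by rewrite /N choice.pickleK.
Qed.

Lemma ae_measure_eq (E F : set T) : measurable E -> measurable F ->
  {ae P, forall x, E x <-> F x} -> P E = P F.
Proof.
move=> mE mF EF; rewrite -[E]setIT -[F]setIT -!integral_indic //.
apply: ae_eq_integral => //.
- by apply/measurable_EFinP; exact: measurable_indic.
- by apply/measurable_EFinP; exact: measurable_indic.
apply: filterS EF => x EFx _; congr (_%:E).
rewrite !indicE; have -> // : (x \in E) = (x \in F).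
by apply/idP/idP => /set_mem /EFx /mem_set.
Qed.

(** The events almost surely equal to an event of [G] form a sigma-algebra: in a countable union the
    exceptional null sets are only countably many. *)
Lemma ae_generated (G K : set (set T)) : sigma_algebra setT G ->
  (forall E, K E -> exists2 F, G F & {ae P, forall x, E x <-> F x}) ->
  forall E, <<s K >> E -> exists2 F, G F & {ae P, forall x, E x <-> F x}.
Proof.
move=> [G0 GC GU] KG; apply: smallest_sub => //; split.
- by exists set0 => //; apply: aeW.
- move=> E [F GF EF]; exists (setT `\` F); first exact: GC.
  by apply: filterS EF => x EFx; split=> -[_ nx]; split=> // /EFx.
- move=> E EG; have /choice[F GF] : forall n, exists F,
      G F /\ {ae P, forall x, E n x <-> F x}.
    by move=> n; have [F ? ?] := EG n; exists F.
  exists (\bigcup_n F n); first by apply: GU => n; have [] := GF n.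
  have := ae_forall_countable (fun n => (GF n).2).
  apply: filterS => x EF; split=> -[n _ nx]; exists n => //; exact/EF.
Qed.

End almost_everywhere.

Lemma reindex_indep d (T : measurableType d) (R : realType) (P :
  probability T R)
    (I J : eqType) d' (S : measurableType d') (X : I -> T -> S) (h :
      J -> I) (g : I -> J) :
  cancel h g -> mutually_independent P X -> mutually_independent P (X \o h).
Proof.
move=> hK iX s A us mA.
have := iX (map h s) (A \o g); rewrite map_inj_uniq //; last exact: can_inj hK.
move=> /(_ us (fun b => mA (g b))); rewrite big_map.
under eq_bigr do rewrite /= hK.
move=> <-; congr (P _); apply/seteqP; split => x /= H.
  by move=> _ /mapP[a as_ ->]; rewrite /= hK; exact: H.
by move=> a as_; have := H (h a) (map_f h as_); rewrite /= hK.
Qed.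

Section approximation.
Context d (T : measurableType d) (R : realType) (P : probability T R).
Implicit Types E F C : set T.

Definition symdiff E F := (E `\` F) `|` (F `\` E).

Lemma measurable_symdiff E F : measurable E -> measurable F ->
  measurable (symdiff E F).
Proof. by move=> mE mF; apply: measurableU; apply: measurableD. Qed.

Lemma symdiff_prob E F : measurable E -> measurable F ->
  `|fine (P E) - fine (P F)| <= fine (P (symdiff E F)).
Proof.
move=> mE mF.
have finP A : measurable A -> P A \is a fin_num by move=> mA;
  exact: fin_num_measure.
have le (A B : set T) : measurable A -> measurable B ->
    fine (P A) - fine (P B) <= fine (P (symdiff A B)).
  move=> mA mB; rewrite lerBlDr -lee_fin EFinD !fineK ?finP //;
    last exact: measurable_symdiff.
  apply: (@le_trans _ _ (P (symdiff A B `|` B))).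
    apply: le_measure; rewrite ?inE //.
      by apply: measurableU => //; exact: measurable_symdiff.
    by move=> x Ax; have [Bx|Bx] := pselect (B x); [right|left; left].
  by apply: measureU2 => //; exact: measurable_symdiff.
rewrite ler_norml le // andbT lerNl opprB.
by rewrite (_ : symdiff E F = symdiff F E) ?le // /symdiff setUC.
Qed.

(** The approximable events form a sigma-algebra. For a countable union, half of [e] pays for
    truncating to a finite union and half for approximating that one, which [fin] does by induction,
    halving the error again at each set. *)
Lemma approx_generated (G : nat -> set (set T)) (K : set (set T)) :
  (forall n, sigma_algebra setT (G n)) -> (forall n, G n `<=` measurable) ->
  (forall m n, (m <= n)%N -> G m `<=` G n) ->
  (forall E, K E -> exists n, G n E) ->
  forall E, <<s K >> E -> forall e : R, 0 < e ->
    exists n C, G n C /\ (P (symdiff E C) <= e%:E)%E.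
Proof.
move=> sG mG GS KG.
suff H E : <<s K >> E -> measurable E /\ forall e : R, 0 < e ->
    exists n C, G n C /\ (P (symdiff E C) <= e%:E)%E by move=> E /H[].
move: E; apply: smallest_sub; last first.
  move=> E /KG[n GE]; split; first exact: (mG n).
  move=> e e0; exists n, E; split => //.
  by rewrite /symdiff !setDv setU0 measure0 lee_fin ltW.
split.
- split=> // e e0; exists 0%N, set0; split; first by have [] := sG 0%N.
  by rewrite /symdiff !setDv setU0 measure0 lee_fin ltW.
- move=> E [mE Ea]; split; first exact: measurableD.
  move=> e /Ea[n [C [GC CE]]]; exists n, (setT `\` C); split.
    by have [_ + _] := sG n; exact.
  rewrite (_ : symdiff _ _ = symdiff E C) //; rewrite /symdiff !setTD.
  by rewrite !setDE !setCK setUC (setIC C) (setIC E) (setIC (~` C)) setIC.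
- move=> F FH; have mF n : measurable (F n) by have [] := FH n.
  have fin N e : 0 < e -> exists n C,
      G n C /\ (P (symdiff (\big[setU/set0]_(k < N) F k) C) <= e%:E)%E.
    elim: N e => [|N IH] e e0.
      exists 0%N, set0; split; first by have [] := sG 0%N.
      by rewrite big_ord0 /symdiff !setDv setU0 measure0 lee_fin ltW.
    have e20 : 0 < e / 2 by rewrite divr_gt0.
    have [n [C [GC CE]]] := IH _ e20; have [m [C' [GC' CE']]] := (FH N).2 _ e20.
    exists (maxn n m), (C `|` C'); split.
      rewrite -(sigma_algebra_id (sG (maxn n m))).
      apply: (@measurableU _ (g_sigma_algebraType (G (maxn n m))));
        rewrite /measurable /= sigma_algebra_id //.
        by apply: GS GC; exact: leq_maxl.
      by apply: GS GC'; exact: leq_maxr.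
    rewrite big_ord_recr /=; set U := \big[setU/set0]_(k < N) F k.
    have mU : measurable U by apply: bigsetU_measurable.
    have mC := mG _ _ GC; have mC' := mG _ _ GC'.
    apply: (@le_trans _ _ (P (symdiff U C `|` symdiff (F N) C'))).
      apply: le_measure; rewrite ?inE.
      + by apply: measurable_symdiff; apply: measurableU.
      + by apply: measurableU; apply: measurable_symdiff.
      + by rewrite /symdiff => x /=; tauto.
    apply: le_trans (measureU2 _ _ _) _; rewrite ?inE //;
      try exact: measurable_symdiff.
    by rewrite (splitr e) EFinD leeD.
  split; first exact: bigcupT_measurable.
  move=> e e0; have e20 : 0 < e / 2 by rewrite divr_gt0.
  set FF := \bigcup_k F k.
  have mFF : measurable FF by exact: bigcupT_measurable.
  pose U N := \big[setU/set0]_(k < N) F k.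
  have mU N : measurable (U N) by apply: bigsetU_measurable.
  have UF N : U N `<=` FF.
    by rewrite /U; elim/big_ind: _ => // [A B AF BF x [/AF|/BF]//|k _];
      exact: bigcup_sup.
  have [N UN] : exists N, (P (FF `\` U N) <= (e / 2)%:E)%E.
    have UFE : \bigcup_k U k.+1 = FF by exact: bigcup_bigsetU_bigcup.
    have PU : (P \o (fun k => U k.+1)) k @[k --> \oo] --> P FF.
      rewrite -UFE; apply: nondecreasing_cvg_mu => //.
        by rewrite UFE.
      by move=> a b ab; apply/subsetPset; apply: subset_bigsetU.
    have PFF : P FF \is a fin_num by exact: fin_num_measure.
    have lt : (P FF - (e / 2)%:E < P FF)%E.
      by rewrite lteBlDr // lteDl // lte_fin.
    apply: contrapT => /forallNP far.
    suff : (P FF <= P FF - (e / 2)%:E)%E by rewrite leNgt lt.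
    apply: cvge_le PU; apply: nearW => k /=.
    have /negP := far k.+1; rewrite -ltNge => /ltW.
    rewrite measureD //; last by rewrite ltey_eq PFF.
    rewrite (setIidr (UF _)) leeBrDr ?fin_num_measure //.
    by rewrite EFinN leeBrDr // addeC.
  have [n [C [GC CE]]] := fin N _ e20; exists n, C; split => //.
  have mC := mG _ _ GC.
  apply: (@le_trans _ _ (P ((FF `\` U N) `|` symdiff (U N) C))).
    apply: le_measure; rewrite ?inE.
    + exact: measurable_symdiff.
    + by apply: measurableU; [exact: measurableD|exact: measurable_symdiff].
    + move=> x; have := @UF N x; rewrite /symdiff /=.
      by have [] := pselect (U N x); tauto.
  apply: le_trans (measureU2 _ _ _) _; rewrite ?inE //.
  + exact: measurableD.
  + exact: measurable_symdiff.
  + by rewrite (splitr e) EFinD leeD.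
Qed.

End approximation.

(** * Stationarity *)

Notation noise_field R := (field (int * int)%type R).

Section noise_shift.
Context (R : realType).

Definition shift_noise (u v : int) (omega : noise_field R) : noise_field R :=
  fun a => omega (a.1 + u, a.2 + v).

Lemma measurable_shift_noise u v : measurable_fun setT (shift_noise u v).
Proof. by apply: field_measurableP => a; exact: field_coord_measurable. Qed.

(** Only time 0 is needed: other times come from translating the noise. The use of [limf] gives a
    value, measurably, even at configurations where the limit fails to exist. *)
Definition incr_limit (w : int -> R) (omega : noise_field R) : field int R :=
  fun i => limf (fun n => height_incr w (fun k j =>
    omega (k, j)) (0 - n%:Z) 0 i).

Lemma measurable_incr_limit (w : int -> R) : weight w ->
  measurable_fun setT (incr_limit w).
Proof.
move=> hw; apply: field_measurableP => i; apply: measurable_limf => n.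
apply: (eq_measurable_fun (fun omega : noise_field R => \sum_(k < n)
    \sum_(j <- incr_supp w k) omega (0 - k%:Z, i + j) * incr_coef w k j)).
  by move=> omega _; rewrite height_incr_finite.
apply: measurable_sum => k; apply: measurable_sum => j.
by apply: measurable_funM => //; exact: field_coord_measurable.
Qed.

Lemma incr_limit_shift (w : int -> R) omega u v i : weight w ->
  incr_limit w (shift_noise u v omega) i =
  limf (fun n => height_incr w (fun k j => omega (k, j)) (u - n%:Z) u (i + v)).
Proof.
move=> hw; congr limf; apply/funext => n.
by rewrite (height_incr_shift hw (fun k j => omega (k, j))) add0r.
Qed.

End noise_shift.

Section stationary_increments.
Context (R : realType) (w : int -> R) d (T : measurableType d)
  (P : probability T R) (xi : int -> int -> {RV P >-> R}) (mu :
    probability R R).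
Hypotheses (hw : weight w) (hspan : span1 w) (hxi : noise xi mu).

Definition config (x : T) : noise_field R := fun a => site xi a x.

Lemma measurable_config : measurable_fun setT config.
Proof. by apply: field_measurableP => a; exact: measurable_site. Qed.

(** A concrete version of the limit field, indexed by all of Z and an exact function of the
    noise. *)
Definition stat_incr (t : int) (x : T) : field int R :=
  incr_limit w (shift_noise t 0 (config x)).

Lemma stat_incrE t x i : stat_incr t x i =
  limf (fun n => height_incr w (fun k j => xi k j x) (t - n%:Z) t i).
Proof. by rewrite /stat_incr incr_limit_shift // addr0. Qed.

Lemma measurable_stat_incr t : measurable_fun setT (stat_incr t).
Proof.
apply: measurableT_comp; first exact: measurable_incr_limit.
apply: measurableT_comp; first exact: measurable_shift_noise.
exact: measurable_config.
Qed.

Lemma stat_incr_cvg t i : cvg_as_L2 P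
  (fun n x => height_incr w (fun k j => xi k j x) (t - n%:Z) t i)
  (fun x => stat_incr t x i).
Proof.
have -> : (fun x => stat_incr t x i) = fun x =>
    limf (fun n => height_incr w (fun k j => xi k j x) (t - n%:Z) t i).
  by apply/funext => x; exact: stat_incrE.
exact: height_incr_cvg hw hspan hxi t i.
Qed.

Lemma stat_incr_ae_cvg : {ae P, forall x, forall t i,
  height_incr w (fun k j =>
    xi k j x) (t - n%:Z) t i @[n --> \oo] --> stat_incr t x i}.
Proof.
apply: ae_forall_countable => t; apply: ae_forall_countable => i.
by have [] := stat_incr_cvg t i.
Qed.

Lemma config_shift_law u v (B : set (noise_field R)) : measurable B ->
  P (config @^-1` (shift_noise u v @^-1` B)) = P (config @^-1` B).
Proof.
move=> mB; have [[_ law] _ _ _] := hxi.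
have iX : mutually_independent P (site xi) by exact: (site_indep hxi).
pose h (a : int * int) := (a.1 + u, a.2 + v).
pose g (a : int * int) := (a.1 - u, a.2 - v).
have hK : cancel h g by case=> a b; rewrite /h /g /= !addrK.
apply: (field_law_unique (X := site xi \o h) (X' := site xi)) => //.
- exact: reindex_indep hK iX.
- by move=> a A mA; rewrite /site /=; have := law (h a).1 (h a).2 A mA;
    have := law a.1 a.2 A mA; rewrite /distribution /pushforward => -> ->.
Qed.

Variable Delta : nat -> {RV P >-> RZ R}.
Hypothesis hDelta : forall (i : int) (t : nat), cvg_as_L2 P
  (fun n x => height_incr w (fun k j => xi k j x) (t%:Z - n%:Z) t%:Z i)
  (fun x => Delta t x i).

(** Limits are unique, and the pairs (t, i) are countable, so one null set serves for all times and
    sites. *)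
Lemma Delta_ae : {ae P, forall x, forall t : nat, Delta t x = stat_incr t x}.
Proof.
have ae1 : {ae P, forall x, forall (t : nat) i,
    height_incr w (fun k j =>
      xi k j x) (t%:Z - n%:Z) t%:Z i @[n --> \oo] --> Delta t x i}.
  apply: ae_forall_countable => t; apply: ae_forall_countable => i.
  by have [] := hDelta i t.
apply: filterS ae1 => x Dx t; apply/funext => i.
by rewrite stat_incrE (limf_cvg (Dx t i)).
Qed.

Lemma Delta_law (t : nat) (A : set (RZ R)) : measurable A ->
  P (Delta t @^-1` A) = P (config @^-1` (incr_limit w @^-1` A)).
Proof.
move=> mA.
have mL : measurable (incr_limit w @^-1` A).
  by rewrite -[X in measurable X]setTI; exact: measurable_incr_limit.
rewrite -(config_shift_law t 0) //; apply: ae_measure_eq.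
- by rewrite -[X in measurable X]setTI; exact: measurable_funPT.
- rewrite -[X in measurable X]setTI; apply: (measurable_stat_incr t) => //.
- by apply: filterS Delta_ae => x Dx; rewrite /preimage /= Dx.
Qed.

(** Up to a null set the tuple is a functional of the noise, and delaying all its times by m amounts
    to translating the noise by m, which preserves its law. *)
Lemma Delta_stationary : stationary_process P (fun t x => Delta t x).
Proof.
move=> n m u A mA.
pose B (k : nat) : set (noise_field R) :=
  [set omega | A [tuple incr_limit w (shift_noise (u i + k)%N 0 omega) | i <
    n]].
have mtup (k : nat) : measurable_fun setT (fun omega : noise_field R =>
    [tuple incr_limit w (shift_noise (u i + k)%N%:Z 0 omega) | i < n]).
  apply/measurable_fun_tnthP => i.
  rewrite (_ : _ \o _ = incr_limit w \o shift_noise (u i + k)%N%:Z 0).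
    by apply: measurableT_comp;
      [exact: measurable_incr_limit|exact: measurable_shift_noise].
  by apply/funext => omega /=; rewrite tnth_mktuple.
have mB k : measurable (B k) by rewrite -[X in measurable X]setTI; exact: mtup.
have DB (k : nat) : P [set x | A [tuple Delta (u i + k)%N x | i < n]] =
    P (config @^-1` B k).
  apply: ae_measure_eq.
  - rewrite -[X in measurable X]setTI.
    have : measurable_fun setT (fun x => [tuple Delta (u i + k)%N x | i < n]).
      apply/measurable_fun_tnthP => i.
      rewrite (_ : _ \o _ = Delta (u i + k)%N); first exact: measurable_funPT.
      by apply/funext => x /=; rewrite tnth_mktuple.
    by apply.
  - by rewrite -[X in measurable X]setTI; exact: measurable_config.
  apply: filterS Delta_ae => x Dx; rewrite /B /=.
  rewrite (_ : [tuple Delta (u i + k)%N x | i < n] =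
    [tuple incr_limit w (shift_noise (u i + k)%N%:Z 0 (config x)) | i < n]) //.
  by apply: eq_from_tnth => i; rewrite !tnth_mktuple Dx.
rewrite DB.
rewrite [in RHS](_ : [set x | _] = [set x | A [tuple Delta (u i + 0)%N x | i <
  n]]);
  last first.
  apply/funext => x /=; congr (A _); apply: eq_from_tnth => i.
  by rewrite !tnth_mktuple addn0.
rewrite DB -[RHS](config_shift_law m 0) //; congr (P _).
rewrite /B /preimage; apply/funext => x /=; congr (A _).
apply: eq_from_tnth => i; rewrite !tnth_mktuple; congr incr_limit.
apply/funext => a; rewrite /shift_noise /= addn0 !addr0;
  congr (config x (_, _)).
by rewrite PoszD addrA.
Qed.

End stationary_increments.

(** * The Markov property and invariance *)

Section harness_step.
Context (R : realType) (w : int -> R).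
Hypothesis hw : weight w.

Definition harness_step (z : field int R * field int R) : field int R :=
  fun i => \sum_(k \in [set: int]) w k * z.1 (i + k) + z.2 i - z.2 (i - 1).

Lemma measurable_harness_step : measurable_fun setT harness_step.
Proof.
apply: field_measurableP => i.
have m1 j : measurable_fun setT (fun z : field int R * field int R => z.1 j).
  apply: (@measurableT_comp _ _ _ _ _ _ (fun f : field int R => f j)) => //.
  exact: field_coord_measurable.
have m2 j : measurable_fun setT (fun z : field int R * field int R => z.2 j).
  apply: (@measurableT_comp _ _ _ _ _ _ (fun f : field int R => f j)) => //.
  exact: field_coord_measurable.
apply: measurable_funB => //; apply: measurable_funD => //.
apply: (eq_measurable_fun (fun z : field int R * field int R =>
    \sum_(k <- supp w) w k * z.1 (i + k))).
  move=> z _; rewrite (fsbigTE (supp w)) // => k /(w_supp hw) ->.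
  by rewrite mul0r.
by apply: measurable_sum => k; apply: measurable_funM.
Qed.

End harness_step.

Section dynamics.
Context (R : realType) (w : int -> R) d (T : measurableType d)
  (P : probability T R) (xi : int -> int -> {RV P >-> R}) (mu :
    probability R R).
Hypotheses (hw : weight w) (hspan : span1 w) (hxi : noise xi mu).
Variable Delta : nat -> {RV P >-> RZ R}.
Hypothesis hDelta : forall (i : int) (t : nat), cvg_as_L2 P
  (fun n x => height_incr w (fun k j => xi k j x) (t%:Z - n%:Z) t%:Z i)
  (fun x => Delta t x i).

Definition noise_row (t : int) (x : T) : field int R := fun j => xi t j x.

Lemma measurable_noise_row t : measurable_fun setT (noise_row t).
Proof. by apply: field_measurableP => j; exact: measurable_funPT. Qed.

(** Pass to the limit in [height_incrS]; the sequence at time t + 1 is read from its index n + 1 so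
    that both sides start from the same past time. The sum over k is finite. *)
Lemma stat_incr_step : {ae P, forall x, forall t : int,
  stat_incr w xi (t + 1) x = harness_step w (stat_incr w xi t x,
    noise_row (t + 1) x)}.
Proof.
apply: filterS (stat_incr_ae_cvg hw hspan hxi) => x cx t; apply/funext => i.
have := cx (t + 1) i; rewrite -cvg_shiftS => /limf_cvg <-.
apply: limf_cvg; rewrite /harness_step /=.
have -> : (fun n : nat => height_incr w (fun k j =>
  xi k j x) (t + 1 - n.+1%:Z) (t + 1) i) =
    fun n : nat => \sum_(k <- supp w) w k *
      height_incr w (fun k j => xi k j x) (t - n%:Z) t (i + k) +
      xi (t + 1) i x - xi (t + 1) (i - 1) x.
  apply/funext => n; rewrite height_incrS // (fsbigTE (supp w)) // => k.
  by move=> /(w_supp hw) ->; rewrite mul0r.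
rewrite (fsbigTE (supp w)); last by move=> k /(w_supp hw) ->; rewrite mul0r.
apply: cvgB; last exact: cvg_cst.
apply: cvgD; last exact: cvg_cst.
elim: (enum_fset (supp w)) => [|k s IH].
  by rewrite big_nil; under eq_fun do rewrite big_nil; exact: cvg_cst.
rewrite big_cons; under eq_fun do rewrite big_cons.
by apply: cvgD => //; apply: cvgM; [exact: cvg_cst|exact: cx].
Qed.

Lemma sigma_of_field_preimage (J : countType) (K : set (int * int))
    (f : T -> field J R) :
  (forall j (C : set R), measurable C -> sigma_of K (site xi) ((fun x =>
    f x j) @^-1` C)) ->
  forall B, measurable B -> sigma_of K (site xi) (f @^-1` B).
Proof.
move=> fK B mB.
pose G := \bigcup_(a in K) preimage_set_system setT (site xi a) measurable.
have mf : measurable_fun (setT : set (g_sigma_algebraType G)) f.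
  by apply: field_measurableP => j _ C mC; rewrite setTI; exact: fK.
by have := mf measurableT B mB; rewrite setTI.
Qed.

Lemma sigma_of_site (K : set (int * int)) a (C : set R) : K a -> measurable C ->
  sigma_of K (site xi) (site xi a @^-1` C).
Proof.
by move=> Ka mC; apply: sub_gen_smallest; exists a => //; exists C => //;
  rewrite setTI.
Qed.

Lemma noise_row_sigma t (B : set (field int R)) : measurable B ->
  sigma_of [set a : int * int | a.1 = t] (site xi) (noise_row t @^-1` B).
Proof.
apply: sigma_of_field_preimage => j C mC.
exact: (@sigma_of_site _ (t, j)).
Qed.

Lemma stat_incr_sigma t (B : set (field int R)) : measurable B ->
  sigma_of [set a : int * int | a.1 <= t] (site xi) (stat_incr w xi t @^-1` B).
Proof.
apply: sigma_of_field_preimage => j.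
pose G := \bigcup_(a in [set a : int * int | a.1 <= t])
  preimage_set_system setT (site xi a) measurable.
have mf : measurable_fun (setT : set (g_sigma_algebraType G))
    (fun x => stat_incr w xi t x j).
  have -> : (fun x => stat_incr w xi t x j) = fun x =>
      limf (fun n => \sum_(k < n) \sum_(l <- incr_supp w k)
        site xi (t - k%:Z, j + l) x * incr_coef w k l).
    apply/funext => x; rewrite stat_incrE //; congr limf; apply/funext => n.
    by rewrite height_incr_finite.
  apply: measurable_limf => n; apply: measurable_sum => k.
  apply: measurable_sum => l; apply: measurable_funM => // _ C mC.
  rewrite setTI; apply: sigma_of_site => //=.
  by rewrite gerDl oppr_le0.
by move=> C mC; have := mf measurableT C mC; rewrite setTI.
Qed.

(** [Delta] itself may use null sets foreign to the noise, hence a representative [F] in place of an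
    inclusion of sigma-algebras. *)
Lemma Delta_ae_past (t : nat) E : sigma_of [set u | (u <= t)%N] (fun t x =>
  Delta t x) E ->
  exists2 F, sigma_of [set a : int * int | a.1 <= t%:Z] (site xi) F &
    {ae P, forall x, E x <-> F x}.
Proof.
apply: ae_generated; first exact: smallest_sigma_algebra.
move=> _ [u /= ut [B mB <-]]; exists (stat_incr w xi u @^-1` B).
  have := stat_incr_sigma (t := u%:Z) mB;
    apply: sigma_of_sub => a /= /le_trans; apply.
  by rewrite lez_nat.
by apply: filterS (Delta_ae hw hDelta) => x Dx; rewrite setTI /preimage /= Dx.
Qed.

(** Replace [E] by its noise representative, which depends on sites of time at most t; row t + 1
    uses none of these. *)
Lemma Delta_row_indep (t : nat) E (B : set (field int R)) :
  sigma_of [set u | (u <= t)%N] (fun t x => Delta t x) E -> measurable B ->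
  (P (E `&` noise_row (t%:Z + 1) @^-1` B) = P E * P (noise_row (t%:Z + 1) @^-1`
    B))%E.
Proof.
move=> DE mB; have [F KF EF] := Delta_ae_past DE.
have mE : measurable E.
  by apply: sigma_of_measurable DE => u; exact: measurable_funPT.
have mF : measurable F by apply: sigma_of_measurable KF; exact: measurable_site.
have mR : measurable (noise_row (t%:Z + 1) @^-1` B).
  by rewrite -[X in measurable X]setTI; exact: measurable_noise_row.
rewrite (ae_measure_eq mE mF EF) (@ae_measure_eq _ _ _ P _ (F `&` noise_row
  (t%:Z + 1) @^-1` B)).
- apply: (sigma_of_indep (measurable_site xi) (site_indep hxi) _ KF).
    2: exact: noise_row_sigma mB.
  by apply/seteqP; split => // a [/= + at1]; rewrite at1; lia.
- exact: measurableI.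
- exact: measurableI.
- by apply: filterS EF => x EFx; split=> -[? ?]; split=> //; exact/EFx.
Qed.

Lemma Delta_step_ae (t : nat) : {ae P, forall x,
  Delta t.+1 x = harness_step w (Delta t x, noise_row (t%:Z + 1) x)}.
Proof.
apply: filterS2 (Delta_ae hw hDelta) stat_incr_step => x Dx Sx.
by rewrite !Dx -Sx intS addrC.
Qed.

End dynamics.

Section markov.
Context (R : realType) (w : int -> R) d (T : measurableType d)
  (P : probability T R) (xi : int -> int -> {RV P >-> R}) (mu :
    probability R R).
Hypotheses (hw : weight w) (hspan : span1 w) (hxi : noise xi mu).
Variable Delta : nat -> {RV P >-> RZ R}.
Hypothesis hDelta : forall (i : int) (t : nat), cvg_as_L2 P
  (fun n x => height_incr w (fun k j => xi k j x) (t%:Z - n%:Z) t%:Z i)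
  (fun x => Delta t x i).

Definition row_law (t : int) :=
  distribution P (mfun_Sub (mem_set (measurable_noise_row xi t))).

Section transition.
Variables (t : nat) (A : set (RZ R)).
Hypothesis mA : measurable A.

Let g (z : field int R * field int R) : \bar R := (\1_A (harness_step w z))%:E.

Let mg : measurable_fun setT g.
Proof.
apply/measurable_EFinP.
by apply: measurableT_comp (measurable_harness_step hw);
  exact: measurable_indic.
Qed.

Let g0 z : (0 <= g z)%E. Proof. by rewrite lee_fin. Qed.

(** The transition probability from [eta] into [A], obtained by integrating out the fresh noise row.
    Evaluated at [Delta t], it is the common version of the two conditional probabilities. *)
Let kE (eta : field int R) := (\int[P]_y g (eta, noise_row xi (t%:Z + 1) y))%E.

Let mkE : measurable_fun setT kE.
Proof.
have -> : kE = fubini_F (row_law (t%:Z + 1)) g.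
  apply/funext => eta; rewrite /kE /fubini_F ge0_integral_pushforward //.
  exact: measurableT_comp.
exact: measurable_fun_fubini_tonelli_F.
Qed.

Let kE01 eta : (0 <= kE eta <= 1)%E.
Proof.
rewrite integral_ge0 //=; apply: (@le_trans _ _ (\int[P]_x (cst 1 x))%E).
  apply: ge0_le_integral => //.
  - apply: measurableT_comp => //; apply: measurableT_comp => //.
    exact: measurable_noise_row.
  - by move=> x _; rewrite /g lee_fin indicE; case: (_ \in _).
by rewrite integral_cst // mul1e; exact: probability_le1.
Qed.

Let k (eta : field int R) : R := fine (kE eta).

Let kK eta : (k eta)%:E = kE eta.
Proof.
have /andP[k0 k1] := kE01 eta.
by rewrite fineK // ge0_fin_numE // (le_lt_trans k1) // ltry.
Qed.

Let mk : measurable_fun setT k.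
Proof.
apply/measurable_EFinP; have -> : EFin \o k = kE by apply/funext => eta;
  exact: kK.
exact: mkE.
Qed.

Let k2 : (fun x => k (Delta t x)) \in Lfun P 1.
Proof.
apply/Lfun1_integrable; apply/integrableP; split.
  by apply/measurable_EFinP; apply: measurableT_comp.
apply: (@le_lt_trans _ _ (\int[P]_x (cst 1 x))%E).
  apply: ge0_le_integral => //.
  - apply/measurable_EFinP; apply: measurableT_comp => //.
    by apply: measurableT_comp.
  - move=> x _; rewrite /= -abse_EFin kK; have /andP[k0 k1] := kE01 (Delta t x).
    by rewrite gee0_abs.
by rewrite integral_cst // mul1e ltey_eq fin_num_measure.
Qed.

Lemma Delta_transition E :
  sigma_of [set u | (u <= t)%N] (fun t x => Delta t x) E ->
  (\int[P]_(x in E) (k (Delta t x))%:E =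
   \int[P]_(x in E) (\1_(Delta t.+1 @^-1` A) x)%:E)%E.
Proof.
move=> DE; rewrite (integral_mul_indic P (fun x => k (Delta t x))).
rewrite (integral_mul_indic P (\1_(Delta t.+1 @^-1` A))).
have mE : measurable E.
  by apply: sigma_of_measurable DE => u; exact: measurable_funPT.
(* The indicator of [E] is carried along with the state, so that the pair is one variable of the
   past, independent of the row [V]. *)
pose U x : R * field int R := (\1_E x, Delta t x).
pose V x := noise_row xi (t%:Z + 1) x.
(* The absolute value makes [f] nonnegative everywhere, as Tonelli requires, and leaves the
   indicator of [E] unchanged. *)
pose f (z : (R * field int R) * field int R) : \bar R :=
  (`|z.1.1| * \1_A (harness_step w (z.1.2, z.2)))%:E.
have mU : measurable_fun setT U.
  by apply: measurable_fun_pair => //; exact: measurable_indic.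
have mV : measurable_fun setT V by exact: measurable_noise_row.
have mf : measurable_fun setT f.
  apply/measurable_EFinP; apply: measurable_funM.
    by apply: measurableT_comp => //; apply: measurableT_comp.
  apply: measurableT_comp; first exact: measurable_indic.
  apply: (measurableT_comp (measurable_harness_step hw)).
  by apply: measurable_fun_pair => //; apply: measurableT_comp.
have UV B C : measurable B -> measurable C ->
    (P (U @^-1` B `&` V @^-1` C) = P (U @^-1` B) * P (V @^-1` C))%E.
  move=> mB mC; apply: (Delta_row_indep hw hxi hDelta) => //.
  pose G := \bigcup_(u in [set u | (u <= t)%N])
    preimage_set_system setT (fun x => Delta u x) measurable.
  have : measurable_fun (setT : set (g_sigma_algebraType G)) U.
    apply: measurable_fun_pair.
      apply: measurable_indic; exact: DE.
    move=> _ D mD; apply: sub_gen_smallest; exists t => //=; first by exists D.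
  by move=> /(_ measurableT B mB); rewrite setTI.
transitivity (\int[P]_x f (U x, V x))%E.
  rewrite (indep_pair_integral mU mV UV mf); last first.
    by move=> z; rewrite lee_fin mulr_ge0.
  apply: eq_integral => x _; rewrite EFinM kK /kE muleC.
  rewrite -ge0_integralZl //.
  - by apply: eq_integral => y _; rewrite /f /g /= EFinM ger0_norm.
  - apply: measurableT_comp => //; exact: measurableT_comp.
apply: ae_eq_integral => //.
- by apply: measurableT_comp => //; exact: measurable_fun_pair.
- apply/measurable_EFinP; apply: measurable_funM; apply: measurable_indic => //.
  by rewrite -[X in measurable X]setTI; exact: measurable_funPT.
apply: filterS (Delta_step_ae hw hspan hxi hDelta t) => x Dx _.
rewrite /f /= ger0_norm // mulrC; congr (_ * _)%:E.
rewrite !indicE -Dx; have -> // :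
  (x \in Delta t.+1 @^-1` A) = (Delta t.+1 x \in A).
by apply/idP/idP => /set_mem Ax; exact/mem_set.
Qed.

(** The candidate is measurable for the smaller sigma-algebra and satisfies the integral identity on
    the larger one, so it serves for both. *)
Lemma Delta_markov_step : exists Y : T -> R,
  is_cond_exp P (sigma_of [set t] (fun t x =>
    Delta t x)) (\1_(Delta t.+1 @^-1` A)) Y /\
  is_cond_exp P (sigma_of [set u | (u <= t)%N] (fun t x => Delta t x))
    (\1_(Delta t.+1 @^-1` A)) Y.
Proof.
exists (fun x => k (Delta t x)).
have sub : sigma_of [set t] (fun t x => Delta t x) `<=`
    sigma_of [set u | (u <= t)%N] (fun t x => Delta t x).
  by apply: sigma_of_sub => u /= ->.
have kS (B : set R) : measurable B ->
    sigma_of [set t] (fun t x => Delta t x) ((fun x => k (Delta t x)) @^-1` B).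
  move=> mB; apply: sub_gen_smallest; exists t => //=; exists (k @^-1` B).
    by rewrite -[X in measurable X]setTI; exact: mk.
  by rewrite setTI.
split; split=> //.
- by move=> E /sub; exact: Delta_transition.
- by move=> B /kS /sub.
- by move=> E; exact: Delta_transition.
Qed.

End transition.

Lemma Delta_markov : markov_process P (fun t x => Delta t x).
Proof. by move=> t A mA; exact: Delta_markov_step. Qed.

End markov.

Lemma indep_pair_law_unique (R : realType) d1 (S1 : measurableType d1)
    d2 (S2 : measurableType d2)
    d (T : measurableType d) (P : probability T R) (U : T -> S1) (V : T -> S2)
    d' (T' : measurableType d') (P' : probability T' R) (U' : T' -> S1) (V' :
      T' -> S2) :
  measurable_fun setT U -> measurable_fun setT V ->
  measurable_fun setT U' -> measurable_fun setT V' ->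
  (forall A B, measurable A -> measurable B ->
    (P (U @^-1` A `&` V @^-1` B) = P (U @^-1` A) * P (V @^-1` B))%E) ->
  (forall A B, measurable A -> measurable B ->
    (P' (U' @^-1` A `&` V' @^-1` B) = P' (U' @^-1` A) * P' (V' @^-1` B))%E) ->
  (forall A, measurable A -> P (U @^-1` A) = P' (U' @^-1` A)) ->
  (forall B, measurable B -> P (V @^-1` B) = P' (V' @^-1` B)) ->
  forall C, measurable C ->
    P ((fun x => (U x, V x)) @^-1` C) = P' ((fun x => (U' x, V' x)) @^-1` C).
Proof.
move=> mU mV mU' mV' UV UV' UU' VV' C mC.
have mUV' : measurable_fun setT (fun x =>
  (U' x, V' x)) by exact: measurable_fun_pair.
rewrite (indep_pair_law mU mV UV mC).
rewrite (@product_measure_unique _ _ _ _ _ _ _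
  (distribution P' (mfun_Sub (mem_set mUV')))) // => A B mA mB.
rewrite [RHS](_ : _ = P (U @^-1` A) * P (V @^-1` B))%E // UU' // VV' //.
exact: UV'.
Qed.

Section invariance.
Context (R : realType) (w : int -> R) d (T : measurableType d)
  (P : probability T R) (xi : int -> int -> {RV P >-> R}) (mu :
    probability R R).
Hypotheses (hw : weight w) (hspan : span1 w) (hxi : noise xi mu).
Variable Delta : nat -> {RV P >-> RZ R}.
Hypothesis hDelta : forall (i : int) (t : nat), cvg_as_L2 P
  (fun n x => height_incr w (fun k j => xi k j x) (t%:Z - n%:Z) t%:Z i)
  (fun x => Delta t x i).

Lemma noise_row_law d' (T' : measurableType d') (P' : probability T' R)
    (xi' : int -> int -> {RV P' >-> R}) (t : int) (B : set (field int R)) :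
  iid_law xi' mu -> measurable B ->
  P (noise_row xi t @^-1` B) = P' (noise_row xi' t @^-1` B).
Proof.
move=> [iX' law'] mB; have [[iX law] _ _ _] := hxi.
have hK : cancel (fun j : int => (t, j)) snd by [].
apply: (field_law_unique (X := site xi \o (fun j => (t, j)))
  (X' := site xi' \o (fun j => (t, j)))) => //.
- exact: reindex_indep hK iX.
- exact: reindex_indep hK iX'.
- move=> j A mA; have := law t j A mA; have := law' t j A mA.
  by rewrite /distribution /pushforward => <- <-.
Qed.

(** By stationarity the law of [Delta 0] is that of [Delta 1], which is almost surely one harness
    step from [Delta 0] and noise row 1. The foreign pair of initial state and row 1 has the same
    marginals and is also independent, hence has the same joint law. *)
Lemma Delta_invariant : invariant_law w mu (distribution P (Delta 0%N)).
Proof.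
move=> d' T' P' xi' eta0 iid' indep' law' A mA.
have D0 : distribution P (Delta 0%N) A = P (Delta 1%N @^-1` A).
  by rewrite /distribution /pushforward !(Delta_law hw hxi hDelta).
rewrite D0.
have mS : measurable (harness_step w @^-1` A).
  by rewrite -[X in measurable X]setTI; exact: measurable_harness_step.
have -> : [set x | A (increments w (fun k j => xi' k j x) (eta0 x) 1)] =
  (fun x => (eta0 x, noise_row xi' 1 x)) @^-1` (harness_step w @^-1` A) by [].
have -> : P (Delta 1%N @^-1` A) =
    P ((fun x => (Delta 0%N x,
      noise_row xi 1 x)) @^-1` (harness_step w @^-1` A)).
  apply: ae_measure_eq.
  - by rewrite -[X in measurable X]setTI; exact: measurable_funPT.
  - rewrite -[X in measurable X]setTI; apply: measurable_fun_pair => //.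
    exact: measurable_noise_row.
  by apply: filterS (Delta_step_ae hw hspan hxi hDelta 0) => x Dx;
    rewrite /preimage /= Dx add0r.
apply: indep_pair_law_unique => //.
- exact: measurable_noise_row.
- exact: measurable_noise_row.
- move=> B C mB mC; apply: indep' => //.
  have := noise_row_sigma (xi := xi') (t := 1) mC.
  by apply: sigma_of_sub => a /= ->.
- move=> B C mB mC.
  have D0E : sigma_of [set u | (u <= 0)%N] (fun t x =>
    Delta t x) (Delta 0%N @^-1` B).
    by apply: sub_gen_smallest; exists 0%N => //; exists B => //; rewrite setTI.
  by have := Delta_row_indep hw hxi hDelta D0E mC; rewrite add0r.
- by move=> B mB; apply/esym; exact: noise_row_law.
Qed.

End invariance.

(** * Ergodicity *)

Section ergodicity.
Context (R : realType) (w : int -> R) d (T : measurableType d)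
  (P : probability T R) (xi : int -> int -> {RV P >-> R}) (mu :
    probability R R).
Hypotheses (hw : weight w) (hspan : span1 w) (hxi : noise xi mu).
Variable Delta : nat -> {RV P >-> RZ R}.
Hypothesis hDelta : forall (i : int) (t : nat), cvg_as_L2 P
  (fun n x => height_incr w (fun k j => xi k j x) (t%:Z - n%:Z) t%:Z i)
  (fun x => Delta t x i).

Lemma shiftZ_image (x : int) (A : set (RZ R)) :
  shiftZ x @` A = shiftZ (- x) @^-1` A.
Proof.
apply/seteqP; split => [_ [e Ae <-]|e Ae] /=.
  rewrite /preimage /= (_ : shiftZ _ _ = e) //.
  by apply/funext => i; rewrite /shiftZ subrK.
by exists (shiftZ (- x) e) => //; apply/funext => i; rewrite /shiftZ addrK.
Qed.

Lemma measurable_shiftZ (x : int) : measurable_fun setT (@shiftZ R x).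
Proof. by apply: field_measurableP => i; exact: field_coord_measurable. Qed.

Lemma shiftZ_incr_limit v (omega : noise_field R) :
  shiftZ v (incr_limit w omega) = incr_limit w (shift_noise 0 v omega).
Proof.
by apply/funext => i; rewrite incr_limit_shift.
Qed.

(** [T] carries no shift, so the argument moves to the space of noise configurations, where
    translations act pointwise and preserve [Q]. *)
Let Q := distribution P (mfun_Sub (mem_set (measurable_config xi))).

Let coord (a : int * int) (omega : noise_field R) : R := omega a.

Let coord_indep : mutually_independent Q coord.
Proof. by move=> J A uJ mA; exact: (site_indep hxi uJ mA). Qed.

Let measurable_coord a : measurable_fun setT (coord a).
Proof. exact: field_coord_measurable. Qed.

Let Q_shift u v B : measurable B -> Q (shift_noise u v @^-1` B) = Q B.
Proof. by move=> mB; exact: (config_shift_law hxi). Qed.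

Let strip (n : nat) := [set a : int * int | - n%:Z <= a.2 <= n%:Z].

(* An event invariant under all spatial shifts is close to an event depending
   on a vertical strip, and two far translates of that strip are independent. *)
Lemma shift_invariant_01 (B : set (noise_field R)) : measurable B ->
  (forall v, shift_noise 0 v @^-1` B = B) -> Q B = 0%E \/ Q B = 1%E.
Proof.
move=> mB Binv.
have finQ A : measurable A -> Q A \is a fin_num by move=> mA;
  exact: fin_num_measure.
pose q := fine (Q B).
have QE : Q B = q%:E by rewrite fineK // finQ.
(* Independence of [B] from itself, q = q^2, is the zero-one law. *)
suff qq : q * (1 - q) = 0.
  move/eqP: qq; rewrite mulf_eq0 subr_eq0 QE => /orP[/eqP ->|/eqP <-];
    by [left|right].
have q0 : 0 <= q by exact: fine_ge0.
have q1 : q <= 1 by rewrite -lee_fin -QE probability_le1.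
apply/eqP; rewrite -normr_le0; apply/ler_addgt0Pl => e e0; rewrite addr0.
(* With c the probability of the approximating event, |q - c| <= e/4 and |q - c^2| <= e/2. Since c +
   q <= 2, also |c^2 - q^2| <= e/2, so |q - q^2| <= e. *)
have e4 : 0 < e / 4 by rewrite divr_gt0.
have GE (n : nat) : sigma_of (strip n) coord `<=` measurable.
  exact: sigma_of_measurable.
have [n [C [GC BC]]] : exists n C, sigma_of (strip n) coord C /\
    (Q (symdiff B C) <= (e / 4)%:E)%E.
  apply: (@approx_generated _ _ _ Q (fun n => sigma_of (strip n) coord)
    (\bigcup_(a in [set: int * int]) preimage_set_system setT (coord a)
      measurable)) => //.
  - by move=> n; exact: smallest_sigma_algebra.
  - move=> m n mn; apply: sigma_of_sub => a /= /andP[a1 a2].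
    by apply/andP; split; lia.
  - move=> E [a _ Ea]; exists `|a.2|%N; apply: sub_gen_smallest;
    exists a => //=.
    by apply/andP; split; lia.
  - exact: field_sigma_of.
have mC := GE _ _ GC.
(* The columns from -n to n are carried to columns n + 2 and beyond, disjoint from the original
   strip. *)
pose v := (2 * n.+1)%N%:Z.
pose C' := shift_noise 0 v @^-1` C.
have mC' : measurable C'.
  by rewrite -[X in measurable X]setTI; exact: measurable_shift_noise.
(* Translating both events costs nothing: [B] is unchanged and [Q] is invariant, so [C']
   approximates [B] as well as [C] does. *)
have BC' : Q (symdiff B C') = Q (symdiff B C).
  rewrite -[RHS](Q_shift 0 v); last exact: measurable_symdiff.
  by rewrite -[X in symdiff X C'](Binv v).
have C'far : sigma_of [set a : int * int | n%:Z < a.2] coord C'.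
  pose far := sigma_of [set a : int * int | n%:Z < a.2] coord.
  have sfar : sigma_algebra setT (image_set_system setT (shift_noise 0 v) far).
    by apply: sigma_algebra_image; exact: smallest_sigma_algebra.
  suff : sigma_of (strip n) coord `<=` image_set_system setT (shift_noise 0 v)
    far.
    by move=> /(_ _ GC); rewrite /image_set_system /= setTI.
  apply: smallest_sub => // _ [a /andP[a1 a2] [D mD <-]].
  rewrite /image_set_system /= !setTI; apply: sub_gen_smallest.
  exists (a.1 + 0, a.2 + v); first by rewrite /= /v; lia.
  by exists D => //; rewrite setTI.
have CC' : (Q (C `&` C') = Q C * Q C')%E.
  apply: (sigma_of_indep measurable_coord coord_indep _ GC C'far).
  by apply/seteqP; split => // a [/= /andP[_ +]]; lia.
have QC' : Q C' = Q C by exact: Q_shift.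
pose c := fine (Q C).
have c0 : 0 <= c by exact: fine_ge0.
have c1 : c <= 1 by rewrite -lee_fin fineK ?finQ // probability_le1.
have d1 : `|q - c| <= e / 4.
  apply: le_trans (symdiff_prob Q mB mC) _.
  by rewrite -lee_fin fineK // finQ //; exact: measurable_symdiff.
have d2 : `|q - c * c| <= e / 4 + e / 4.
  have -> : c * c = fine (Q (C `&` C')).
    by rewrite CC' QC' fineM // finQ.
  apply: le_trans (symdiff_prob Q mB (measurableI _ _ mC mC')) _.
  rewrite -lee_fin fineK; last by apply: finQ;
    apply: measurable_symdiff => //; exact: measurableI.
  apply: (@le_trans _ _ (Q (symdiff B C `|` symdiff B C'))).
    apply: le_measure; rewrite ?inE.
    + by apply: measurable_symdiff => //; exact: measurableI.
    + by apply: measurableU; exact: measurable_symdiff.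
    + by rewrite /symdiff => x /=; have [] := pselect (C x);
      have [] := pselect (C' x); tauto.
  apply: le_trans (measureU2 _ _ _) _; try exact: measurable_symdiff.
  by rewrite EFinD leeD //; have := BC; rewrite -BC'.
move: d1 d2; rewrite !ler_norml => /andP[? ?] /andP[? ?].
by apply/andP; split; nra.
Qed.

(** [incr_limit] intertwines the spatial shifts of the increments with those of the noise, so a
    shift-invariant event pulls back to a shift-invariant noise event. *)
Lemma Delta_ergodic : ergodic (distribution P (Delta 0%N)).
Proof.
have nuE A : measurable A ->
  distribution P (Delta 0%N) A = Q (incr_limit w @^-1` A).
  by move=> mA; exact: (Delta_law hw hxi hDelta).
have mL A : measurable A -> measurable (incr_limit w @^-1` A).
  by move=> mA; rewrite -[X in measurable X]setTI; exact: measurable_incr_limit.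
have shiftE v A : incr_limit w @^-1` (shiftZ v @^-1` A) =
    shift_noise 0 v @^-1` (incr_limit w @^-1` A).
  by apply/seteqP; split => omega; rewrite /preimage /= shiftZ_incr_limit.
split=> [A v mA|B mB Binv].
  rewrite shiftZ_image !nuE //; first by rewrite shiftE Q_shift //; exact: mL.
  by rewrite -[X in measurable X]setTI; exact: measurable_shiftZ.
rewrite nuE //; apply: shift_invariant_01; first exact: mL.
by move=> v; rewrite -shiftE -{2}(Binv (- v)) shiftZ_image opprK.
Qed.

End ergodicity.

Theorem theorem2p4 (R : realType) (w : int -> R)
    (d : measure_display) (T : measurableType d) (P : probability T R)
    (xi : int -> int -> {RV P >-> R}) (mu : probability R R)
    (hw : weight w) (hspan : span1 w) (hxi : noise xi mu) :
  let M (t : nat) (i : int) (s : nat) (x : T) :=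
    height_incr w (fun k j => xi k j x) (t%:Z - s%:Z) t%:Z i in
  [/\ forall (i : int) (t : nat),
        L2_martingale P (past_noise xi t%:Z) (M t i),
      exists Delta : nat -> {RV P >-> RZ R},
        forall (i : int) (t : nat),
          cvg_as_L2 P (M t i) (fun x => Delta t x i)
    & forall Delta : nat -> {RV P >-> RZ R},
        (forall (i : int) (t : nat),
          cvg_as_L2 P (M t i) (fun x => Delta t x i)) ->
        [/\ stationary_process P (fun t x => Delta t x),
            markov_process P (fun t x => Delta t x),
            invariant_law w mu (distribution P (Delta 0%N))
          & ergodic (distribution P (Delta 0%N)) ] ].
Proof.
move=> M; split=> [i t||Delta hDelta].
- exact: (height_incr_martingale hw hxi).
- exists (fun t => mfun_Sub (mem_set (measurable_stat_incr xi hw t))) => i t.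
  exact: (stat_incr_cvg hw hspan hxi).
split.
- exact: (Delta_stationary hw hxi hDelta).
- exact: (Delta_markov hw hspan hxi hDelta).
- exact: (Delta_invariant hw hspan hxi hDelta).
- exact: (Delta_ergodic hw hxi hDelta).
Qed.
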